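(* Consider the Sinkhorn distributionally robust state estimation (DRSE) design problem $$\min_{\Phi=[\Phi_x\ \Phi_y]}\ \sup_{\mathbb{P}\in\mathcal{D}_\epsilon(\hat{\mathbb{P}}_N,\theta)}\mathbb{E}_{\xi\sim\mathbb{P}}\left[\lVert\Phi Q\xi\rVert^2\right]\quad\text{s.t. } \Phi R=I,\ \Phi_x,\Phi_y\ \text{block lower-triangular},$$ in the limiting regime $\epsilon\to\infty$ with $0\le\theta/\epsilon<\infty$. In this limit: (i) the problem is feasible if and only if $$\theta\ge\mathrm{Tr}\{\Sigma\}+\frac1N\sum_{i=1}^N\hat\xi_i^\top\hat\xi_i ;$$ that is, the smallest radius $\theta$ for which the problem is feasible converges, as $\epsilon\to\infty$, to the right-hand side; (ii) when this condition holds, the problem yields, in the limit, the same optimal solution $(\Phi_x^{\star},\Phi_y^{\star})$ as the $\mathcal{H}_2$ design problem $$\min_{\Phi=[\Phi_x\ \Phi_y]}\ \left\lVert\Phi Q\Sigma^{1/2}\right\rVert_F^2\quad\text{s.t. } \Phi R=I,\ \Phi_x,\Phi_y\ \text{block lower-triangular}.$$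
   Context: System and matrices. Consider $x(t+1)=A_tx(t)+B_tw(t)$, $y(t)=C_tx(t)+D_tw(t)$ with known $A_t\in\mathbb{R}^{n_x\times n_x}$, $B_t\in\mathbb{R}^{n_x\times n_w}$, $C_t\in\mathbb{R}^{n_y\times n_x}$, $D_t\in\mathbb{R}^{n_y\times n_w}$ (assumed uniformly completely observable), initial time $t_0$ and horizon $T\ge n_x$. The uncertainty is $\xi=[e^\top(t_0)\ w^\top(t_0)\ \cdots\ w^\top(t_0+T-1)]^\top\in\mathbb{R}^{n_\xi}$, $n_\xi=n_x+Tn_w$, where $e(t_0)$ is the initial estimation error. Let $Z\in\mathbb{R}^{(T+1)n_x\times(T+1)n_x}$ be the block-downshift matrix (identity blocks $I_{n_x}$ on the first block subdiagonal, zeros elsewhere), and $\bar A=\mathrm{diag}\{A_{t_0},\dots,A_{t_0+T-1},0_{n_x\times n_x}\}$, $\bar B=\mathrm{diag}\{I_{n_x},B_{t_0},\dots,B_{t_0+T-1}\}$, $\bar C=\mathrm{diag}\{0_{n_y\times n_x},C_{t_0},\dots,C_{t_0+T-1}\}$, $\bar D=\mathrm{diag}\{0_{n_y\times n_x},D_{t_0},\dots,D_{t_0+T-1}\}$. Set $$R=\begin{bmatrix}I-Z\bar A\\ \bar CZ\end{bmatrix},\qquad Q=\begin{bmatrix}\bar B\\-\bar D\end{bmatrix}.$$ The variables are $\Phi_x\in\mathbb{R}^{(T+1)n_x\times(T+1)n_x}$ and $\Phi_y\in\mathbb{R}^{(T+1)n_x\times(T+1)n_y}$; block lower-triangularity is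 with respect to the $(T+1)\times(T+1)$ block partition. Sinkhorn ambiguity set. $\hat\xi_1,\dots,\hat\xi_N\in\mathbb{R}^{n_\xi}$ are given samples, $\hat{\mathbb{P}}_N=\frac1N\sum_i\delta_{\hat\xi_i}$, $\beta=\mathcal{N}(0,\Sigma)$ with $\Sigma\succ0$, $\alpha=\hat{\mathbb{P}}_N$. $\mathcal{D}_\epsilon(\hat{\mathbb{P}}_N,\theta)$ is the set of probability distributions $\mathbb{P}\ll\beta$ on $\mathbb{R}^{n_\xi}$ such that $$\inf_{\pi}\left\{\mathbb{E}_{(\xi,\xi')\sim\pi}[\lVert\xi-\xi'\rVert^2]+\epsilon\,\mathrm{KL}(\pi|\alpha\odot\beta)\right\}\le\theta,$$ the infimum being over joint distributions $\pi$ with marginals $\hat{\mathbb{P}}_N$ and $\mathbb{P}$; $\alpha\odot\beta$ is the product measure and $\mathrm{KL}$ is the Kullback–Leibler divergence. The design problem is called feasible if its inner maximization is feasible, i.e. $\mathcal{D}_\epsilon(\hat{\mathbb{P}}_N,\theta)\ne\emptyset$. Regime. ''$\epsilon\to\infty$ with $0\le\theta/\epsilon<\infty$'' covers fixed finite $\theta$, and $\theta\to\infty$ with $\theta/\epsilon$ tending to a finite limit. Coincidence of the optimal solutions in the limit means that the DRSE design problem obtained by letting $\epsilon\to\infty$ has as its optimal $(\Phi_x,\Phi_y)$ the optimal solution of the $\mathcal{H}_2$ problem.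
   Formalization: Part (ii) is stated only for θ/ε → 0 (all fixed θ, and θ → ∞ with θ = o(ε)); if θ/ε → c > 0 the limiting problem is a worst case over KL(P|β) ≤ c and its optimal solution can differ from the H2 one, so the claim fails there. *)

(* Defs.v *)
From HB Require Import structures.
From mathcomp Require Import all_boot all_order all_algebra.
From mathcomp Require Import all_classical all_reals all_analysis.
Set Implicit Arguments.
Unset Strict Implicit.
Unset Printing Implicit Defensive.
Import Order.TTheory GRing.Theory Num.Theory.
Import numFieldNormedType.Exports.
Local Open Scope classical_set_scope.
Local Open Scope ring_scope.

(* The norm `|M| of the library on matrices is the max norm; sqfro is the
   squared Frobenius norm, i.e. the squared Euclidean norm on columns. *)
Definition sqfro (R : realType) (m n : nat) (M : 'M[R]_(m, n)) : R :=
  \sum_(i < m) \sum_(j < n) M i j ^+ 2.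

Definition quad (R : realType) (n : nat) (M : 'M[R]_n) (v : 'cV[R]_n) : R :=
  (v^T *m M *m v) ord0 ord0.

Definition posdef (R : realType) (n : nat) (M : 'M[R]_n) : Prop :=
  M^T = M /\ forall v : 'cV[R]_n, v != 0 -> 0 < quad M v.

(* S is the (unique) symmetric positive semidefinite square root of M. *)
Definition psd_sqrt (R : realType) (n : nat) (S M : 'M[R]_n) : Prop :=
  [/\ S^T = S, forall v : 'cV[R]_n, 0 <= quad S v & S *m S = M].

(* R^n with its product (= Borel) sigma-algebra. *)
Notation vec R n := (n.-tuple (measurableTypeR R)).

Definition colv (R : realType) (n : nat) (x : vec R n) : 'cV[R]_n :=
  \col_i tnth x i.

Section system.
Variables (R : realType) (nx nw ny : nat).
Variables (A : nat -> 'M[R]_(nx, nx)) (B : nat -> 'M[R]_(nx, nw)).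
Variables (C : nat -> 'M[R]_(ny, nx)) (D : nat -> 'M[R]_(ny, nw)).

(* State transition matrix A_(t+k-1) ... A_(t+1) A_t. *)
Fixpoint transition (t k : nat) : 'M[R]_nx :=
  if k is k'.+1 then A (t + k')%N *m transition t k' else 1%:M.

Definition obs_gramian (t s : nat) : 'M[R]_nx :=
  \sum_(k < s) (C (t + k)%N *m transition t k)^T *m (C (t + k)%N *m transition t k).

(* a I <= obs_gramian t s <= b I in the Loewner order, uniformly in t. *)
Definition uniformly_completely_observable : Prop :=
  exists (s : nat) (a b : R), [/\ 0 < a, 0 < b & forall t (v : 'cV[R]_nx),
    a * sqfro v <= quad (obs_gramian t s) v <= b * sqfro v].

(* Sizes of the blocks e(t0), w(t0), ..., w(t0+T-1) of the uncertainty. *)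
Definition xi_size (k : nat) : nat := if k is _.+1 then nw else nx.

Definition n_xi (T : nat) : nat := (\sum_(k < T.+1) xi_size k)%N.

Variables (t0 T : nat).

Definition Zmx : 'M[R]_(\sum_(i < T.+1) nx, \sum_(j < T.+1) nx) :=
  \mxblock_(i < T.+1, j < T.+1)
    (if i == j.+1 :> nat then 1%:M else 0 : 'M[R]_nx).

Definition Abar : 'M[R]_(\sum_(i < T.+1) nx, \sum_(j < T.+1) nx) :=
  \mxblock_(i < T.+1, j < T.+1)
    (if (i == j) && (i < T)%N then A (t0 + i)%N else 0 : 'M[R]_nx).

Definition Bblock (k : nat) : 'M[R]_(nx, xi_size k) :=
  if k is k'.+1 return 'M[R]_(nx, xi_size k) then B (t0 + k')%N else 1%:M.

Definition Cblock (k : nat) : 'M[R]_(ny, nx) :=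
  if k is k'.+1 then C (t0 + k')%N else 0.

Definition Dblock (k : nat) : 'M[R]_(ny, xi_size k) :=
  if k is k'.+1 return 'M[R]_(ny, xi_size k) then D (t0 + k')%N else 0.

Definition Bbar : 'M[R]_(\sum_(i < T.+1) nx, n_xi T) :=
  \mxblock_(i < T.+1, j < T.+1)
    (if i == j then Bblock j else 0 : 'M[R]_(nx, xi_size j)).

Definition Cbar : 'M[R]_(\sum_(i < T.+1) ny, \sum_(j < T.+1) nx) :=
  \mxblock_(i < T.+1, j < T.+1)
    (if i == j then Cblock j else 0 : 'M[R]_(ny, nx)).

Definition Dbar : 'M[R]_(\sum_(i < T.+1) ny, n_xi T) :=
  \mxblock_(i < T.+1, j < T.+1)
    (if i == j then Dblock j else 0 : 'M[R]_(ny, xi_size j)).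

Definition Rmx : 'M[R]_(\sum_(i < T.+1) nx + \sum_(i < T.+1) ny,
                        \sum_(j < T.+1) nx) :=
  col_mx (1%:M - Zmx *m Abar) (Cbar *m Zmx).

Definition Qmx : 'M[R]_(\sum_(i < T.+1) nx + \sum_(i < T.+1) ny, n_xi T) :=
  col_mx Bbar (- Dbar).

Definition block_lower (m p q : nat)
    (M : 'M[R]_(\sum_(i < m) p, \sum_(j < m) q)) : Prop :=
  forall i j : 'I_m, (i < j)%N ->
    submxblock (p_ := fun=> p) (q_ := fun=> q) M i j = 0.

(* Pairs (Phi_x, Phi_y). *)
Definition design : Type :=
  ('M[R]_(\sum_(i < T.+1) nx, \sum_(j < T.+1) nx) *
   'M[R]_(\sum_(i < T.+1) nx, \sum_(j < T.+1) ny))%type.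

Definition Phimx (Phi : design) := row_mx Phi.1 Phi.2.

Definition design_constraints (Phi : design) : Prop :=
  [/\ Phimx Phi *m Rmx = 1%:M, block_lower Phi.1 & block_lower Phi.2].

Definition H2_cost (Shalf : 'M[R]_(n_xi T)) (Phi : design) : R :=
  sqfro (Phimx Phi *m Qmx *m Shalf).

Definition sq_error (Phi : design) (xi : vec R (n_xi T)) : R :=
  sqfro (Phimx Phi *m Qmx *m colv xi).

End system.

Lemma n_xiE nx nw T : n_xi nx nw T = (nx + T * nw)%N.
Proof. by rewrite /n_xi big_ord_recl /= sum_nat_const card_ord. Qed.

Definition optimal (R : realType) (X : Type) (feas : X -> Prop)
    (cost : X -> \bar R) (x : X) : Prop :=
  feas x /\ forall y, feas y -> (cost x <= cost y)%E.

(* Indexing the samples by 'I_N.+1 makes their number positive, so that the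
   empirical distribution is a probability. *)
Section empirical_measure.
Context d (T : measurableType d) (R : realType) (N : nat) (xihat : 'I_N.+1 -> T).
Local Open Scope ereal_scope.

Definition empirical (S : set T) : \bar R :=
  (N.+1%:R^-1)%:E * \sum_(i < N.+1) \d_(xihat i) S.

Let empirical0 : empirical set0 = 0.
Proof. by rewrite /empirical big1 ?mule0 // => i _; rewrite measure0. Qed.

Let empirical_ge0 S : 0 <= empirical S.
Proof.
by rewrite /empirical mule_ge0 ?lee_fin ?invr_ge0 ?ler0n // sume_ge0.
Qed.

Let empirical_sigma_additive : semi_sigma_additive empirical.
Proof.
move=> F mF tF mUF; rewrite /empirical.
rewrite [X in X @ _ --> _](_ : _ = fun n =>
   (N.+1%:R^-1)%:E * \sum_(i < N.+1) \sum_(0 <= k < n) \d_(xihat i) (F k)).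
  apply: cvgeZl => //; apply: cvg_nnesum => [i _|i _].
    by apply: nearW => n; apply: sume_ge0.
  exact: measure_semi_sigma_additive.
apply/funext => n; rewrite -ge0_sume_distrr; last first.
  by move=> k _; apply: sume_ge0.
by rewrite exchange_big.
Qed.

HB.instance Definition _ := isMeasure.Build _ _ _ empirical
  empirical0 empirical_ge0 empirical_sigma_additive.

Let empirical_setT : empirical setT = 1.
Proof.
rewrite /empirical (eq_bigr (fun=> 1%:E)) => [|i _]; last by rewrite diracT.
by rewrite sumEFin sumr_const card_ord -EFinM mulVf // pnatr_eq0.
Qed.

HB.instance Definition _ := Measure_isProbability.Build _ _ _ empirical
  empirical_setT.

End empirical_measure.

Section sinkhorn.
Variables (R : realType) (n : nat).
Local Open Scope ereal_scope.

(* N(0, Sigma), Sigma > 0: every nonzero linear form <a, .> has the law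
   N(0, a^T Sigma a). The library's normal_prob takes the standard deviation. *)
Definition is_centered_normal (Sigma : 'M[R]_n)
    (beta : probability (vec R n) R) : Prop :=
  forall a : 'cV[R]_n, a != 0%R -> forall S : set (measurableTypeR R),
    measurable S ->
    pushforward beta (fun x : vec R n => (a^T *m colv x)%R ord0 ord0) S =
    normal_prob 0 (Num.sqrt (quad Sigma a)) S.

(* KL(pi | rho), equal to +oo unless pi << rho. *)
Definition KL d (X : measurableType d) (pi : probability X R)
    (rho : probability X R) : \bar R :=
  if `[< pi `<< rho >] then
    \int[pi]_x (ln (fine (Radon_Nikodym (charge_of_finite_measure pi) rho x)))%:E
  else +oo.

Definition coupling (alpha : probability (vec R n) R)
    (P : probability (vec R n) R)
    (pi : probability (vec R n * vec R n)%type R) : Prop :=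
  (forall S, measurable S -> pi (S `*` setT) = alpha S) /\
  (forall S, measurable S -> pi (setT `*` S) = P S).

Variables (N : nat) (xihat : 'I_N.+1 -> vec R n) (beta : probability (vec R n) R).

Definition sinkhorn_cost (eps : R)
    (pi : probability (vec R n * vec R n)%type R) : \bar R :=
  \int[pi]_u (sqfro (colv u.1 - colv u.2)%R)%:E +
  eps%:E * KL pi (empirical R xihat \x beta).

Definition sinkhorn_discrepancy (eps : R) (P : probability (vec R n) R)
    : \bar R :=
  ereal_inf [set sinkhorn_cost eps pi | pi in coupling (empirical R xihat) P].

Definition ambiguity_set (eps theta : R) : set (probability (vec R n) R) :=
  [set P : probability (vec R n) R |
    P `<< beta /\ sinkhorn_discrepancy eps P <= theta%:E].

Definition worst_case (eps theta : R) (f : vec R n -> R) : \bar R :=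
  ereal_sup [set \int[P]_xi (f xi)%:E | P in ambiguity_set eps theta].

End sinkhorn.

(* Main.v *)
Require Import Defs.
From HB Require Import structures.
From mathcomp Require Import all_boot all_order all_algebra.
From mathcomp Require Import ring lra.
From mathcomp Require Import all_classical all_reals all_analysis.
From mathcomp Require Import measurable_realfun.
Import Order.TTheory GRing.Theory Num.Theory.
Import numFieldNormedType.Exports.
Local Open Scope classical_set_scope.
Local Open Scope ring_scope.

(** Write c(x, y) = |x - y|^2, alpha for the empirical distribution and
    rho = alpha x beta.  Everything follows from one variational inequality for
    the relative entropy, [KL_ge_log_moment]: for nonnegative u and w,
      int u dpi + 1 <= KL(pi | rho) + int w dpi + int exp(u - w) drho,
    obtained by integrating 1 + t <= exp t at t = u - w - ln (dpi/drho).

    Feasibility.  Let Z(x) = int exp(- c(x, y) / eps) dbeta(y).  Applied to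
    u = - ln Z(x) and w = c / eps, for which exp(u - w) has rho-integral 1, the
    inequality says that every coupling of alpha costs at least
      sinkhorn_min(eps) = - eps * mean_i ln Z(xihat_i),
    and the Gibbs coupling, of density exp(u - w) with respect to rho, costs
    exactly that.  Hence the ambiguity set is nonempty if and only if
    sinkhorn_min(eps) <= theta.  By Jensen's inequality and by
    exp(- t) <= 1 - t + t^2,
      radius - K / eps <= sinkhorn_min(eps) <= radius,
    where radius = mean_i int c(xihat_i, y) dbeta(y)
                 = Tr Sigma + mean_i |xihat_i|^2
    and K is finite because a Gaussian vector has fourth moments.

    Worst case.  As soon as radius <= theta, the product coupling rho, of zero
    entropy and of cost radius, puts beta itself in the ambiguity set, so the
    worst case of a cost f is at least int f dbeta.  Conversely a member P of
    the ambiguity set has couplings of relative entropy at most about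
    theta / eps.  The inequality with u = lam f(y), w = 0 then gives
      lam int f dP <= theta / eps + int exp(lam f) dbeta - 1
                   <= theta / eps + lam int f dbeta + lam^2 K'
    with K' independent of P; the last step uses that a quadratic f has a finite
    exponential moment under the Gaussian beta.  Dividing by lam, the worst case
    converges to int f dbeta once theta / eps tends to 0, because lam is
    arbitrarily small.  For f(xi) = |Phi Q xi|^2 this integral is
    |Phi Q Sigma^(1/2)|_F^2, so that the limiting cost is the H2 cost itself,
    design by design, and the optimal designs coincide. *)

Set Implicit Arguments.
Unset Strict Implicit.
Unset Printing Implicit Defensive.

(** * Elementary bounds on the exponential *)

Section exponential_bounds.
Variable R : realType.
Implicit Types t : R.

Lemma expRN_le t : 0 <= t -> expR (- t) <= 1 - t + t ^+ 2.
Proof.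
move=> t0; rewrite expRN.
have t1 : 0 < 1 + t by rewrite ltr_wpDr.
apply: (@le_trans _ _ (1 + t)^-1).
  by rewrite lef_pV2 ?posrE ?expR_gt0// expR_ge1Dx.
rewrite -[leLHS]mul1r ler_pdivrMr//.
have : 0 <= t ^+ 3 by rewrite exprn_ge0.
nra.
Qed.

Lemma expR_le t : 0 <= t -> expR t <= 1 + t + t ^+ 2 * expR t.
Proof.
move=> t0; have := expR_ge1Dx (- t); rewrite expRN => h1.
have e0 := expR_gt0 t.
have h2 : (1 - t) * expR t <= 1.
  by rewrite -ler_pdivlMr// mul1r.
nra.
Qed.

Lemma sqr_le_expR t : 0 <= t -> t ^+ 2 <= 2 * expR t.
Proof.
move=> t0; have := @expR_ge1Dxn R t 1 t0.
rewrite (_ : 2`!%:R = 2)// => h.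
have : t ^+ 2 / 2 <= expR t by apply: le_trans h; rewrite lerDr.
by rewrite ler_pdivrMr// mulrC.
Qed.

Lemma mulr_expRN_le1 t : t * expR (- t) <= 1.
Proof.
rewrite expRN ler_pdivrMr ?expR_gt0// mul1r.
by apply: le_trans (expR_ge1Dx t); rewrite lerDr.
Qed.

End exponential_bounds.

(** * Densities and relative entropy *)

Section density.
Context d (X : measurableType d) (R : realType).
Local Open Scope ereal_scope.

Lemma integral_cst_probability (P : probability X R) (r : \bar R) :
  \int[P]_x r = r.
Proof.
rewrite -[LHS]/(\int[P]_x (cst r x)) integral_cst// -[RHS]mule1.
by congr (_ * _); exact: probability_setT.
Qed.

Lemma density_dominates (mu nu : {measure set X -> \bar R}) (g : X -> \bar R) :
  measurable_fun setT g ->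
  (forall A, measurable A -> nu A = \int[mu]_(x in A) g x) -> nu `<< mu.
Proof.
move=> mg nuE; apply/null_content_dominatesP => A mA A0.
by rewrite nuE// null_set_integral//; exact: measurable_funTS.
Qed.

Lemma integral_density (mu : {sigma_finite_measure set X -> \bar R})
    (nu : {finite_measure set X -> \bar R}) (g : X -> R) (f : X -> \bar R) :
  measurable_fun setT g ->
  (forall A, measurable A -> nu A = \int[mu]_(x in A) (g x)%:E) ->
  measurable_fun setT f -> (forall x, 0 <= f x) ->
  \int[nu]_x f x = \int[mu]_x (f x * (g x)%:E).
Proof.
move=> mg nuE mf f0.
have mg' : measurable_fun setT (EFin \o g) by exact/measurable_EFinP.
have numu : nu `<< mu by exact: (density_dominates mg').
have iRN := Radon_Nikodym_SigmaFinite.f_integrable numu.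
have mRN := measurable_int _ iRN.
rewrite -(Radon_Nikodym_SigmaFinite.change_of_variables numu)//.
apply: ae_eq_integral => //; [exact: emeasurable_funM..|].
apply: ae_eqe_mul2l; apply: integral_ae_eq => // A _ mA.
by rewrite -Radon_Nikodym_SigmaFinite.f_integral// nuE.
Qed.

(** The measure of density exp v with respect to mu.  The proofs that v is
    measurable and that exp v has integral 1 are arguments so that the measure
    and probability structures can be attached to it. *)
Definition exp_density (mu : {measure set X -> \bar R}) (v : X -> R)
  (mv : measurable_fun setT v) (v1 : \int[mu]_x (expR (v x))%:E = 1) A : \bar R
  := \int[mu]_(x in A) (expR (v x))%:E.

Section exp_density_probability.
Variables (mu : {measure set X -> \bar R}) (v : X -> R).
Hypotheses (mv : measurable_fun setT v).
Hypotheses (v1 : \int[mu]_x (expR (v x))%:E = 1).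
Let nu := exp_density mv v1.

Let mexp : measurable_fun setT (fun x => (expR (v x))%:E).
Proof. by apply/measurable_EFinP; exact: measurableT_comp. Qed.

Let nu0 : nu set0 = 0. Proof. by rewrite /nu /exp_density integral_set0. Qed.

Let nu_ge0 A : 0 <= nu A.
Proof. by apply: integral_ge0 => x _; rewrite lee_fin expR_ge0. Qed.

Let nu_sigma_additive : semi_sigma_additive nu.
Proof.
move=> /= F mF tF mUF; rewrite /nu /exp_density integral_bigcup//=.
  by apply: is_cvg_ereal_nneg_natsum_cond => n _ _; exact: nu_ge0.
apply: (integrableS _ _ (@subsetT _ _)) => //.
apply/integrableP; split => //.
under eq_integral do rewrite /= ger0_norm ?expR_ge0//.
by rewrite v1 ltry.
Qed.

HB.instance Definition _ := isMeasure.Build _ _ _ (exp_density mv v1)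
  nu0 nu_ge0 nu_sigma_additive.
HB.instance Definition _ := Measure_isProbability.Build _ _ _
  (exp_density mv v1) v1.

Definition exp_probability : probability X R := exp_density mv v1.

End exp_density_probability.
End density.

Section relative_entropy.
Context d (X : measurableType d) (R : realType).
Local Open Scope ereal_scope.
Variables pi rho : probability X R.

Lemma KL_log_density (v : X -> R) : measurable_fun setT v ->
  (forall A, measurable A -> pi A = \int[rho]_(x in A) (expR (v x))%:E) ->
  KL pi rho = \int[pi]_x (v x)%:E.
Proof.
move=> mv piE.
have mev : measurable_fun setT (fun x => (expR (v x))%:E).
  by apply/measurable_EFinP; exact: measurableT_comp.
have h : pi `<< rho by exact: density_dominates piE.
rewrite /KL asboolT//.
have iRN : rho.-integrable setT
    (Radon_Nikodym (charge_of_finite_measure pi) rho).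
  exact: Radon_Nikodym_integrable.
have mRN := measurable_int _ iRN.
have vE : ae_eq rho setT (Radon_Nikodym (charge_of_finite_measure pi) rho)
    (fun x => (expR (v x))%:E).
  apply: integral_ae_eq => // A _ mA.
  by rewrite -Radon_Nikodym_integral//; exact: piE.
apply: ae_eq_integral => //.
- apply/measurable_EFinP; apply: measurableT_comp; first exact: measurable_ln.
  by apply: measurableT_comp mRN; exact: fine_measurable.
- exact/measurable_EFinP.
- apply: (null_dominates_ae_eq measurableT h).
  by apply: filterS vE => x /= + _ => ->//=; rewrite expRK.
Qed.

(* A version of dpi/drho that is nonnegative everywhere, unlike the
   Radon-Nikodym derivative of a signed charge, and its logarithm. *)
Let RN : X -> \bar R := Radon_Nikodym_SigmaFinite.f pi rho.
Let l x : R := ln (fine (RN x)).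

Let mRN : pi `<< rho -> measurable_fun setT RN.
Proof.
move=> h; exact: measurable_int (Radon_Nikodym_SigmaFinite.f_integrable h).
Qed.

Let ml : pi `<< rho -> measurable_fun setT l.
Proof.
move=> h; apply: measurableT_comp; first exact: measurable_ln.
by apply: measurableT_comp (mRN h); exact: fine_measurable.
Qed.

Let KL_eq : pi `<< rho -> KL pi rho = \int[pi]_x (l x)%:E.
Proof.
move=> h; rewrite /KL asboolT//.
have mRN' : measurable_fun setT
    (Radon_Nikodym (charge_of_finite_measure pi) rho).
  by apply: measurable_int; exact: Radon_Nikodym_integrable.
apply: ae_eq_integral => //.
- apply/measurable_EFinP; apply: measurableT_comp; first exact: measurable_ln.
  by apply: measurableT_comp mRN'; exact: fine_measurable.
- exact/measurable_EFinP/ml.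
- apply: (null_dominates_ae_eq measurableT h).
  have := ae_eq_Radon_Nikodym_SigmaFinite h (@measurableT _ X).
  by apply: filterS => x /= + _ => <-.
Qed.

(* Only an inequality: the points where dpi/drho vanishes are lost. *)
Let integral_expR_sub_le (v : X -> R) : pi `<< rho -> measurable_fun setT v ->
  \int[pi]_x (expR (v x - l x))%:E <= \int[rho]_x (expR (v x))%:E.
Proof.
move=> h mv.
have mvl : measurable_fun setT (fun x => (expR (v x - l x))%:E).
  apply/measurable_EFinP; apply: measurableT_comp => //.
  by apply: measurable_funB => //; exact: ml.
rewrite -(Radon_Nikodym_SigmaFinite.change_of_variables h)//.
apply: ge0_le_integral => //.
- move=> x _; apply: mule_ge0; first by rewrite lee_fin expR_ge0.
  exact: Radon_Nikodym_SigmaFinite.f_ge0.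
- by apply: emeasurable_funM => //; exact: mRN.
- by apply/measurable_EFinP; apply: measurableT_comp.
- move=> x _; have := Radon_Nikodym_SigmaFinite.f_ge0 h x.
  rewrite /l /RN -(fineK (Radon_Nikodym_SigmaFinite.f_fin_num h x)).
  rewrite lee_fin -EFinM lee_fin /=.
  rewrite le_eqVlt => /predU1P[<-|g0]; first by rewrite mulr0 expR_ge0.
  by rewrite expRB lnK ?posrE// divfK// gt_eqF.
Qed.

(** The Gibbs (Donsker-Varadhan) variational inequality, linearised by
    ln s <= s - 1.  Splitting the test function as u - w with u, w >= 0 keeps
    all the integrals meaningful without any integrability hypothesis. *)
Lemma KL_ge_log_moment (u w : X -> R) :
  measurable_fun setT u -> measurable_fun setT w ->
  (forall x, (0 <= u x)%R) -> (forall x, (0 <= w x)%R) ->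
  \int[pi]_x (u x)%:E + 1 <=
  KL pi rho + (\int[pi]_x (w x)%:E + \int[rho]_x (expR (u x - w x))%:E).
Proof.
move=> mu mw u0 w0.
have [h|h] := pselect (pi `<< rho); last first.
  rewrite /KL asboolF// addye ?leey//.
  by rewrite gt_eqF// (@lt_le_trans _ _ 0)// adde_ge0//;
    apply: integral_ge0 => x _; rewrite lee_fin ?expR_ge0.
have mlE : measurable_fun setT (EFin \o l) by apply/measurable_EFinP/ml.
have mlp := measurable_funepos mlE; have mln := measurable_funeneg mlE.
pose a := \int[pi]_x (EFin \o l)^\+ x; pose b := \int[pi]_x (EFin \o l)^\- x.
have a0 : 0 <= a by apply: integral_ge0 => x _; exact: funepos_ge0.
have b0 : 0 <= b by apply: integral_ge0 => x _; exact: funeneg_ge0.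
have mexp (v : X -> R) : measurable_fun setT v ->
    measurable_fun setT (fun x => (expR (v x - l x))%:E).
  move=> mv; apply/measurable_EFinP; apply: measurableT_comp => //.
  by apply: measurable_funB => //; exact: ml.
(* The negative part of the entropy is finite: max (- l, 0) <= exp (- l). *)
have b1 : b <= 1.
  apply: (@le_trans _ _ (\int[pi]_x (expR (cst 0%R x - l x))%:E)).
    apply: ge0_le_integral => //; first exact: mexp.
    move=> x _; rewrite funenegE /= -EFin_max lee_fin ge_max expR_ge0 andbT.
    rewrite sub0r.
    by apply: le_trans (expR_ge1Dx _); rewrite lerDr.
  apply: (le_trans (integral_expR_sub_le h _)) => //=.
  by rewrite expR0 integral_cst_probability.
have bfin : b \is a fin_num by rewrite ge0_fin_numE// (le_lt_trans b1)// ltry.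
(* The integral of 1 + t <= exp t at t = u - w - l, all terms moved to the side
   on which they are nonnegative. *)
have key : \int[pi]_x (u x)%:E + 1 + b <=
    a + (\int[pi]_x (w x)%:E + \int[pi]_x (expR (u x - w x - l x))%:E).
  have -> : 1 = \int[pi]_x (cst 1%E x) :> \bar R.
    by rewrite integral_cst_probability.
  have muE : measurable_fun setT (EFin \o u) by apply/measurable_EFinP.
  have mwE : measurable_fun setT (EFin \o w) by apply/measurable_EFinP.
  have mE : measurable_fun setT (fun x => (expR (u x - w x - l x))%:E).
    by apply: (mexp (fun x => u x - w x)%R); exact: measurable_funB.
  rewrite -ge0_integralD//; last by move=> x _; rewrite lee_fin.
  rewrite -ge0_integralD//; last 2 first.
  - by move=> x _; rewrite adde_ge0// lee_fin.
  - exact: emeasurable_funD.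
  rewrite -[X in _ + X]ge0_integralD//;
    [|by move=> x _; rewrite lee_fin ?expR_ge0..].
  rewrite -ge0_integralD//; last 2 first.
  - by move=> x _; rewrite adde_ge0// lee_fin ?expR_ge0.
  - exact: emeasurable_funD.
  apply: ge0_le_integral => //.
  - by move=> x _; rewrite !adde_ge0// lee_fin.
  - by do 2 apply: emeasurable_funD => //.
  - by do 2 apply: emeasurable_funD => //.
  - move=> x _; rewrite funeposE funenegE /= -!EFin_max -!EFinD lee_fin.
    have := expR_ge1Dx (u x - w x - l x)%R.
    by case: (leP (l x) 0%R) => ?; case: (leP (- l x)%R 0%R) => ?; lra.
have e1 := integral_expR_sub_le h (measurable_funB mu mw).
have -> : KL pi rho = a - b by rewrite KL_eq// integralE.
rewrite [leRHS]addeAC leeBrDr//; apply: (le_trans key).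
by rewrite leeD2l// leeD2l.
Qed.

End relative_entropy.

(** * Moments of the centred normal distribution *)

Section normal_moments.
Variables (R : realType) (s : R).
Hypothesis s0 : 0 < s.
Local Open Scope ereal_scope.

Let sn0 : s != 0%R. Proof. by rewrite gt_eqF. Qed.

(** The integrand exp(c t^2) times the density of standard deviation s is, up to
    the factor 1/r, the density of standard deviation s / r, where
    r^2 = 1 - 2 c s^2. *)
Lemma normal_exp_sqr_moment (c : R) : (2 * c * s ^+ 2 < 1)%R ->
  \int[normal_prob 0 s]_t (expR (c * t ^+ 2))%:E =
  ((Num.sqrt (1 - 2 * c * s ^+ 2))^-1)%:E.
Proof.
move=> c1; set r := Num.sqrt _.
have r0 : (0 < r)%R by rewrite sqrtr_gt0 subr_gt0.
have rr : (r ^+ 2 = 1 - 2 * c * s ^+ 2)%R by rewrite sqr_sqrtr// subr_ge0 ltW.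
have rn0 : r != 0%R by rewrite gt_eqF.
rewrite (@integral_density _ _ R lebesgue_measure (normal_prob 0 s)
  (normal_pdf 0 s))//;
  last 2 first.
- exact: measurable_normal_pdf.
- apply/measurable_EFinP; apply: measurableT_comp => //.
  by apply: measurable_funM => //; exact: measurable_funX.
have srn0 : (s / r != 0)%R by rewrite mulf_neq0// invr_eq0.
transitivity
  (\int[lebesgue_measure]_t ((r^-1)%:E * (normal_pdf 0 (s / r) t)%:E)).
  apply: eq_integral => t _; rewrite -!EFinM; congr EFin.
  rewrite !normal_pdfE//= /normal_fun subr0.
  have -> : normal_peak (s / r) = (r * normal_peak s)%R.
    rewrite /normal_peak -!mulrnAr.
    rewrite (sqrtrM _ (sqr_ge0 (s / r))) (sqrtrM _ (sqr_ge0 s)) !sqrtr_sqr.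
    rewrite !ger0_norm ?divr_ge0 ?(ltW r0) ?(ltW s0)//.
    by rewrite !invfM invrK mulrA [(r * _)%R]mulrC.
  rewrite mulrCA -(GRing.mulrA r) (GRing.mulrA r^-1%R) mulVf// mul1r.
  congr (_ * _)%R.
  rewrite -expRD; congr expR.
  rewrite -[in LHS](mulr_natr (s ^+ 2)) -[in RHS](mulr_natr ((s / r) ^+ 2)).
  rewrite expr_div_n rr; field.
  by rewrite sn0 subr_eq0 gt_eqF.
rewrite ge0_integralZl//; last 3 first.
- by apply/measurable_EFinP; exact: measurable_normal_pdf.
- by move=> t _; rewrite lee_fin normal_pdf_ge0.
- by rewrite lee_fin invr_ge0 ltW.
by rewrite integral_normal_pdf mule1.
Qed.

Let mexp c : measurable_fun (@setT R) (fun t : R => (expR (c * t ^+ 2))%:E).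
Proof.
apply/measurable_EFinP; apply: measurableT_comp => //.
by apply: measurable_funM => //; exact: measurable_funX.
Qed.

Let msqr : measurable_fun (@setT R) (fun t : R => (t ^+ 2)%:E).
Proof. by apply/measurable_EFinP; exact: measurable_funX. Qed.

(** The second moment is squeezed out of the explicit exponential moments: c t^2
    <= exp(c t^2) - 1 for c of both signs, and c tends to 0. *)
Lemma normal_second_moment :
  \int[normal_prob 0 s]_t (t ^+ 2)%:E = (s ^+ 2)%:E.
Proof.
set E := (X in X = _).
have s2 : (0 < s ^+ 2)%R by rewrite exprn_gt0.
have E0 : 0 <= E by apply: integral_ge0 => t _; rewrite lee_fin sqr_ge0.
have up x : (0 < x < 1)%R ->
    (x / (2 * s ^+ 2))%:E * E + 1 <= ((Num.sqrt (1 - x))^-1)%:E.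
  move=> /andP[x0 x1]; pose c := (x / (2 * s ^+ 2))%R.
  have c0 : (0 < c)%R by rewrite divr_gt0// mulr_gt0.
  have cx : (2 * c * s ^+ 2 = x)%R by rewrite /c; field.
  rewrite -{2}cx -normal_exp_sqr_moment ?cx// -/c -ge0_integralZl//;
    last 2 first.
  - by move=> t _; rewrite lee_fin sqr_ge0.
  - by rewrite lee_fin ltW.
  rewrite -[X in _ + X <= _](integral_cst_probability (normal_prob 0 s)).
  rewrite -ge0_integralD//; last 2 first.
  - by move=> t _; rewrite -EFinM lee_fin mulr_ge0 ?sqr_ge0// ltW.
  - exact: measurable_funeM.
  apply: ge0_le_integral => //.
  - move=> t _; rewrite -EFinM -EFinD lee_fin addr_ge0// mulr_ge0 ?sqr_ge0//.
    exact: ltW.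
  - by apply: emeasurable_funD => //; exact: measurable_funeM.
  - exact: mexp.
  - by move=> t _; rewrite -EFinM -EFinD lee_fin addrC expR_ge1Dx.
have lo x : (0 < x)%R ->
    1 <= ((Num.sqrt (1 + x))^-1)%:E + (x / (2 * s ^+ 2))%:E * E.
  move=> x0; pose c := (x / (2 * s ^+ 2))%R.
  have c0 : (0 < c)%R by rewrite divr_gt0// mulr_gt0.
  have cx : (1 + x = 1 - 2 * (- c) * s ^+ 2)%R by rewrite /c; field.
  rewrite cx -normal_exp_sqr_moment; last by rewrite -subr_gt0 -cx addr_gt0.
  rewrite -/c -ge0_integralZl//; last 2 first.
  - by move=> t _; rewrite lee_fin sqr_ge0.
  - by rewrite lee_fin ltW.
  rewrite -ge0_integralD//; last 3 first.
  - exact: mexp.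
  - by move=> t _; rewrite -EFinM lee_fin mulr_ge0 ?sqr_ge0// ltW.
  - exact: measurable_funeM.
  rewrite -[leLHS](integral_cst_probability (normal_prob 0 s)).
  apply: ge0_le_integral => //.
  - by apply: emeasurable_funD; [exact: mexp|exact: measurable_funeM].
  - move=> t _; rewrite -EFinM -EFinD lee_fin -lerBlDr.
    by apply: le_trans (expR_ge1Dx _); rewrite mulNr.
have Efin : E \is a fin_num.
  rewrite ge0_fin_numE//.
  have /up : (0 < (2^-1 : R) < 1)%R by rewrite invr_gt0 ltr0n/= invf_lt1 ?ltr1n.
  rewrite ltey; apply: contraTneq => ->.
  rewrite gt0_muley ?lte_fin ?divr_gt0 ?mulr_gt0// addye//.
move: up lo; rewrite -(fineK Efin); set e := fine E => up lo.
congr EFin; apply/eqP; rewrite eq_le; apply/andP; split.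
- rewrite leNgt; apply/negP => se.
  (* The bound reads e (1 - x) (2 - x) <= 2 s^2, and this x is chosen so that
     e (2 - 3 x) = e + s^2 > 2 s^2. *)
  pose x := ((e - s ^+ 2) / (3 * e))%R.
  have e0 : (0 < e)%R by exact: lt_trans se.
  have xe : (x * (3 * e) = e - s ^+ 2)%R
    by rewrite /x divfK// gt_eqF// mulr_gt0.
  have x0 : (0 < x)%R by rewrite divr_gt0 ?subr_gt0// mulr_gt0.
  have x1 : (x < 1)%R by nra.
  have := up x; rewrite x0 x1 => /(_ isT); rewrite -EFinM -EFinD lee_fin.
  set r := Num.sqrt _.
  have r0 : (0 < r)%R by rewrite sqrtr_gt0 subr_gt0.
  have rr : (r ^+ 2 = 1 - x)%R by rewrite sqr_sqrtr// subr_ge0 ltW.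
  have r1 : (r < 1)%R by nra.
  rewrite -[leRHS]mul1r ler_pdivlMr//.
  have -> : (x / (2 * s ^+ 2) * e = x * e / (2 * s ^+ 2))%R by field.
  move=> h.
  have {}h : (x * e * r <= (1 - r) * (2 * s ^+ 2))%R.
    by rewrite -ler_pdivrMr ?mulr_gt0//; nra.
  have h2 : (e * r * (1 + r) <= 2 * s ^+ 2)%R.
    have : (x * (e * r * (1 + r)) <= x * (2 * s ^+ 2))%R by nra.
    by rewrite ler_pM2l.
  have h3 : (1 - x <= r)%R by nra.
  have h4 : (e * ((1 - x) * (2 - x)) <= e * (r * (1 + r)))%R.
    by rewrite ler_pM2l//; nra.
  have : (e * x ^+ 2 > 0)%R by rewrite mulr_gt0// exprn_gt0.
  nra.
- rewrite leNgt; apply/negP => se.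
  have e0 : (0 <= e)%R by rewrite -lee_fin /e fineK.
  (* The bound reads 2 s^2 <= e (1 + x) (2 + x) <= e (2 + 4 x), and this x makes
     e (2 + 4 x) <= 2 e + (s^2 - e) = e + s^2 < 2 s^2. *)
  pose x := ((s ^+ 2 - e) / (4 * s ^+ 2))%R.
  have xe : (x * (4 * s ^+ 2) = s ^+ 2 - e)%R
    by rewrite /x divfK// gt_eqF// mulr_gt0.
  have x0 : (0 < x)%R by rewrite divr_gt0 ?subr_gt0// mulr_gt0.
  have := lo x x0; rewrite -EFinM -EFinD lee_fin.
  set r := Num.sqrt _.
  have r0 : (0 < r)%R by rewrite sqrtr_gt0 addr_gt0.
  have rr : (r ^+ 2 = 1 + x)%R by rewrite sqr_sqrtr// addr_ge0// ltW.
  have r1 : (1 < r)%R by nra.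
  have -> : (x / (2 * s ^+ 2) * e = x * e / (2 * s ^+ 2))%R by field.
  rewrite -lerBlDl => h.
  have {}h : ((r - 1) * (2 * s ^+ 2) <= x * e * r)%R.
    have : ((1 - r^-1) * (r * (2 * s ^+ 2)) <=
        x * e / (2 * s ^+ 2) * (r * (2 * s ^+ 2)))%R.
      by rewrite ler_pM2r// !mulr_gt0.
    rewrite (_ : (_ - _) * _ = (r - 1) * (2 * s ^+ 2))%R; last first.
      by field; rewrite gt_eqF.
    rewrite (_ : x * e / _ * _ = x * e * r)%R//.
    by field; rewrite gt_eqF.
  have h2 : (2 * s ^+ 2 <= e * r * (1 + r))%R.
    have : (x * (2 * s ^+ 2) <= x * (e * r * (1 + r)))%R by nra.
    by rewrite ler_pM2l.
  have x1 : (x <= 1)%R by nra.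
  have h3 : (r <= 1 + x)%R by nra.
  have h4 : (e * (r * (1 + r)) <= e * ((1 + x) * (2 + x)))%R.
    by rewrite ler_wpM2l//; nra.
  have h5 : (e * ((1 + x) * (2 + x)) <= e * (2 + 4 * x))%R.
    by rewrite ler_wpM2l//; nra.
  have h6 : (x * e <= x * s ^+ 2)%R by rewrite ler_pM2l// ltW.
  nra.
Qed.

End normal_moments.

(** * Integration against the empirical distribution *)

Section empirical_integral.
Context d (T : measurableType d) (R : realType).
Variables (N : nat) (xihat : 'I_N.+1 -> T).
Local Open Scope ereal_scope.

Lemma ge0_integral_empirical (f : T -> \bar R) :
  measurable_fun setT f -> (forall x, 0 <= f x) ->
  \int[empirical R xihat]_x f x = (N.+1%:R^-1)%:E * \sum_(i < N.+1) f (xihat i).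
Proof.
move=> mf f0.
have N0 : (0 <= N.+1%:R^-1 :> R)%R by rewrite invr_ge0.
pose m k : {measure set T -> \bar R} := \d_(xihat (inord k)).
rewrite (eq_measure_integral (mscale (NngNum N0) (msum m N.+1))); last first.
  move=> A mA _; rewrite /mscale /msum /= /empirical; congr (_ * _).
  by apply: eq_bigr => i _; rewrite /m inord_val.
rewrite ge0_integral_mscale//= ge0_integral_measure_sum//; congr (_ * _).
by apply: eq_bigr => i _; rewrite integral_dirac// diracT mul1e /= inord_val.
Qed.

Lemma ge0_integral_empirical_prod d' (Y : measurableType d')
    (beta : probability Y R) (f : T * Y -> \bar R) :
  measurable_fun setT f -> (forall x, 0 <= f x) ->
  \int[empirical R xihat \x beta]_u f u =
  (N.+1%:R^-1)%:E * \sum_(i < N.+1) \int[beta]_y f (xihat i, y).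
Proof.
move=> mf f0; rewrite fubini_tonelli1// ge0_integral_empirical//.
  exact: measurable_fun_fubini_tonelli_F.
by move=> x; apply: integral_ge0.
Qed.

End empirical_integral.

(** * Functions with a finite exponential moment *)

Section exp_moment.
Context d (X : measurableType d) (R : realType) (mu : probability X R).
Local Open Scope ereal_scope.

(** f is measurable, nonnegative, and exp(lam f) is integrable for some
    lam > 0. *)
Definition has_exp_moment (f : X -> R) : Prop :=
  [/\ measurable_fun setT f, forall x, (0 <= f x)%R &
   exists2 lam : R, (0 < lam)%R & \int[mu]_x (expR (lam * f x))%:E < +oo].

Lemma measurable_expRZ (f : X -> R) (lam : R) : measurable_fun setT f ->
  measurable_fun setT (fun x => (expR (lam * f x))%:E).
Proof.
move=> mf; apply/measurable_EFinP; apply: measurableT_comp => //.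
exact: measurable_funM.
Qed.

Lemma le_expRZ_integral (f g : X -> R) (lam lam' : R) :
  measurable_fun setT f -> measurable_fun setT g ->
  (forall x, (lam * f x <= lam' * g x)%R) ->
  \int[mu]_x (expR (lam * f x))%:E <= \int[mu]_x (expR (lam' * g x))%:E.
Proof.
move=> mf mg fg; apply: ge0_le_integral => //.
- exact: measurable_expRZ.
- exact: measurable_expRZ.
- by move=> x _; rewrite lee_fin ler_expR.
Qed.

Lemma has_exp_moment_le (f g : X -> R) (k : R) : measurable_fun setT f ->
  (0 < k)%R -> (forall x, (0 <= f x <= k * g x)%R) ->
  has_exp_moment g -> has_exp_moment f.
Proof.
move=> mf k0 fg [mg g0 [lam lam0 lamg]].
split => //; first by move=> x; case/andP: (fg x).
exists (lam / k)%R; first by rewrite divr_gt0.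
apply: le_lt_trans lamg; apply: le_expRZ_integral => // x.
rewrite -mulrA ler_pM2l// mulrC ler_pdivrMr// mulrC.
by case/andP: (fg x).
Qed.

Lemma has_exp_moment_cst (c : R) : (0 <= c)%R -> has_exp_moment (cst c).
Proof.
move=> c0; split => //; exists 1%R => //=.
by rewrite integral_cst_probability ltry.
Qed.

(** No independence is needed: with 2 c <= min(a, b), c (f + g) is at most the
    larger of a f and b g. *)
Lemma has_exp_momentD (f g : X -> R) :
  has_exp_moment f -> has_exp_moment g -> has_exp_moment (f \+ g)%R.
Proof.
move=> [mf f0 [a a0 af]] [mg g0 [b b0 bg]].
split; [exact: measurable_funD|by move=> x /=; rewrite addr_ge0|].
pose c := (Num.min a b / 2)%R.
have ab0 : (0 < Num.min a b)%R by rewrite lt_min a0.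
have c0 : (0 < c)%R by rewrite divr_gt0.
have ca : (2 * c <= a)%R by rewrite /c mulrC divfK// ge_min lexx.
have cb : (2 * c <= b)%R by rewrite /c mulrC divfK// ge_min lexx orbT.
exists c => //.
apply: (@le_lt_trans _ _
  (\int[mu]_x ((expR (a * f x))%:E + (expR (b * g x))%:E))).
  apply: ge0_le_integral => //.
  - by apply: measurable_expRZ; exact: measurable_funD.
  - by apply: emeasurable_funD; exact: measurable_expRZ.
  - move=> x _; rewrite -EFinD lee_fin /=; have := f0 x; have := g0 x => gx fx.
    have [fg|/ltW gf] := leP (f x) (g x).
      by apply: (@le_trans _ _ (expR (b * g x)));
        rewrite ?ler_expR ?lerDr ?expR_ge0//; nra.
    by apply: (@le_trans _ _ (expR (a * f x)));
      rewrite ?ler_expR ?lerDl ?expR_ge0//; nra.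
rewrite ge0_integralD//; first exact: lte_add_pinfty.
- exact: measurable_expRZ.
- exact: measurable_expRZ.
Qed.

Lemma has_exp_moment_sum (I : Type) (s : seq I) (f : I -> X -> R) :
  (forall i, has_exp_moment (f i)) ->
  has_exp_moment (fun x => \sum_(i <- s) f i x)%R.
Proof.
move=> hf; elim: s => [|i s IH].
  by under eq_fun do rewrite big_nil; exact: has_exp_moment_cst.
by under eq_fun do rewrite big_cons; exact: has_exp_momentD.
Qed.

Lemma has_exp_moment_integral_sqr (f : X -> R) : has_exp_moment f ->
  \int[mu]_x (f x ^+ 2)%:E < +oo.
Proof.
move=> [mf f0 [a a0 af]].
have m2 : measurable_fun setT (fun x => (f x ^+ 2)%:E).
  by apply/measurable_EFinP; exact: measurable_funX.
have K0 : (0 <= 2 / a ^+ 2)%R by rewrite divr_ge0// exprn_ge0// ltW.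
apply: (@le_lt_trans _ _ (\int[mu]_x ((2 / a ^+ 2)%:E * (expR (a * f x))%:E))).
  apply: ge0_le_integral => //.
  - by move=> x _; rewrite lee_fin exprn_ge0.
  - by apply: measurable_funeM; exact: measurable_expRZ.
  - move=> x _; rewrite -EFinM lee_fin mulrAC ler_pdivlMr ?exprn_gt0//.
    by rewrite mulrC -exprMn sqr_le_expR// mulr_ge0// ltW.
rewrite ge0_integralZl//.
- by rewrite lte_mul_pinfty.
- exact: measurable_expRZ.
Qed.

(** A first-order upper bound, with quadratic remainder, on the Laplace
    transform of f near 0. *)
Lemma has_exp_moment_expansion (f : X -> R) : has_exp_moment f ->
  exists lam0 K : R, [/\ (0 < lam0)%R, (0 <= K)%R &
    forall lam, (0 < lam <= lam0)%R -> \int[mu]_x (expR (lam * f x))%:E <=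
      1 + (lam%:E * \int[mu]_x (f x)%:E + (lam ^+ 2 * K)%:E)].
Proof.
move=> [mf f0 [a a0 af]].
pose I := \int[mu]_x (expR (a * f x))%:E.
have I0 : 0 <= I by apply: integral_ge0 => x _; rewrite lee_fin expR_ge0.
have Ifin : I \is a fin_num by rewrite ge0_fin_numE.
(* Half of the exponent a absorbs f^2, the other half dominates exp(lam f). *)
pose b := (a / 2)%R; have b0 : (0 < b)%R by rewrite divr_gt0.
pose k := (2 / b ^+ 2)%R.
have k0 : (0 < k)%R by rewrite divr_gt0// exprn_gt0.
exists b, (k * fine I)%R; split => //.
  by rewrite mulr_ge0// ?fine_ge0// ltW.
move=> lam /andP[l0 lb].
have -> : (lam ^+ 2 * (k * fine I))%:E = (lam ^+ 2 * k)%:E * I.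
  by rewrite -[in RHS](fineK Ifin) -EFinM mulrA.
have lk0 : (0 <= lam ^+ 2 * k)%R by rewrite mulr_ge0 ?exprn_ge0// ltW.
rewrite -ge0_integralZl//; last 3 first.
- exact/measurable_EFinP.
- by move=> x _; rewrite lee_fin.
- by rewrite lee_fin ltW.
rewrite /I -[X in _ + (_ + X)]ge0_integralZl//; last exact: measurable_expRZ.
have mlf : measurable_fun setT (fun x => lam%:E * (f x)%:E).
  by apply: measurable_funeM; exact/measurable_EFinP.
have mlk : measurable_fun setT
    (fun x => (lam ^+ 2 * k)%:E * (expR (a * f x))%:E).
  by apply: measurable_funeM; exact: measurable_expRZ.
have lf0 x : 0 <= lam%:E * (f x)%:E by rewrite -EFinM lee_fin mulr_ge0// ltW.
have lkf0 x : 0 <= (lam ^+ 2 * k)%:E * (expR (a * f x))%:E.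
  by rewrite -EFinM lee_fin mulr_ge0// expR_ge0.
rewrite -ge0_integralD// -[X in _ <= X + _](integral_cst_probability mu).
rewrite -ge0_integralD//; last 2 first.
- by move=> x _; rewrite adde_ge0.
- exact: emeasurable_funD.
apply: ge0_le_integral => //.
- exact: measurable_expRZ.
- by apply: emeasurable_funD => //; exact: emeasurable_funD.
- move=> x _; rewrite -!EFinM -!EFinD lee_fin.
  have fx := f0 x.
  have lf : (0 <= lam * f x)%R by rewrite mulr_ge0// ltW.
  apply: (le_trans (expR_le lf)); rewrite -addrA lerD2l lerD2l.
  rewrite exprMn -(GRing.mulrA (lam ^+ 2)%R) -(GRing.mulrA (lam ^+ 2)%R k).
  rewrite ler_pM2l ?exprn_gt0//.
  have h1 : (f x ^+ 2 <= k * expR (b * f x))%R.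
    rewrite /k mulrAC ler_pdivlMr ?exprn_gt0// mulrC -exprMn.
    by rewrite sqr_le_expR// mulr_ge0// ltW.
  have h2 : (expR (lam * f x) <= expR (b * f x))%R
    by rewrite ler_expR ler_wpM2r.
  have -> : (a * f x = b * f x + b * f x)%R by rewrite /b; field.
  rewrite expRD mulrA; by apply: ler_pM => //; exact: exprn_ge0.
Qed.

End exp_moment.

(** * Quadratic functions of a Gaussian vector *)

Section vectors.
Variables (R : realType) (n : nat).

(** The linear form y |-> <a, y>. *)
Definition linear_form (a : 'cV[R]_n) (y : vec R n) : R :=
  (a^T *m colv y) ord0 ord0.

Lemma linear_formE a y : linear_form a y = \sum_(j < n) a j ord0 * tnth y j.
Proof. by rewrite /linear_form mxE; apply: eq_bigr => j _; rewrite !mxE. Qed.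

Lemma linear_form0 y : linear_form 0 y = 0.
Proof. by rewrite linear_formE big1// => j _; rewrite mxE mul0r. Qed.

Lemma linear_formN a y : linear_form (- a) y = - linear_form a y.
Proof.
by rewrite !linear_formE -sumrN; apply: eq_bigr => j _; rewrite mxE mulNr.
Qed.

Lemma measurable_linear_form a : measurable_fun setT (linear_form a).
Proof.
rewrite (_ : linear_form a = fun y => \sum_(j < n) a j ord0 * tnth y j).
  apply: measurable_sum => j; apply: measurable_funM => //.
  exact: measurable_tnth.
by apply/funext => y; exact: linear_formE.
Qed.

Lemma linear_form_delta i (y : vec R n) :
  linear_form (delta_mx i ord0) y = tnth y i.
Proof.
rewrite linear_formE (bigD1 i)//= big1 ?addr0 => [|j ji].
  by rewrite mxE !eqxx mul1r.
by rewrite mxE (negbTE ji) mul0r.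
Qed.

Lemma sqfro_ge0 m p (M : 'M[R]_(m, p)) : 0 <= sqfro M.
Proof. by do 2 apply: sumr_ge0 => ? _; exact: sqr_ge0. Qed.

Lemma sqfro_cVE m (v : 'cV[R]_m) : sqfro v = \sum_i v i ord0 ^+ 2.
Proof. by apply: eq_bigr => i _; rewrite big_ord1. Qed.

Lemma sqfro_mul_colv m (M : 'M[R]_(m, n)) y :
  sqfro (M *m colv y) = \sum_i linear_form (row i M)^T y ^+ 2.
Proof.
rewrite sqfro_cVE; apply: eq_bigr => i _; congr (_ ^+ 2).
by rewrite /linear_form trmxK -row_mul [RHS]mxE.
Qed.

(** The squared Euclidean distance, which is the transport cost. *)
Definition sqdist (x y : vec R n) : R := sqfro (colv x - colv y).

Lemma sqdistE x y : sqdist x y = \sum_i (tnth x i - tnth y i) ^+ 2.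
Proof. by rewrite /sqdist sqfro_cVE; apply: eq_bigr => i _; rewrite !mxE. Qed.

Lemma sqdist_ge0 x y : 0 <= sqdist x y. Proof. exact: sqfro_ge0. Qed.

Lemma measurable_sqdist :
  measurable_fun setT (fun u : vec R n * vec R n => sqdist u.1 u.2).
Proof.
under eq_fun do rewrite sqdistE.
apply: measurable_sum => i; apply: measurable_funX.
apply: measurable_funB.
  exact: (measurableT_comp (measurable_tnth i) measurable_fst).
exact: (measurableT_comp (measurable_tnth i) measurable_snd).
Qed.

End vectors.

Section gaussian_vectors.
Variables (R : realType) (n : nat) (Sigma : 'M[R]_n).
Variable beta : probability (vec R n) R.
Hypotheses (hSigma : posdef Sigma) (hbeta : is_centered_normal Sigma beta).
Local Open Scope ereal_scope.

Let quadN a : quad Sigma (- a) = quad Sigma a.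
Proof.
have e : ((- a)^T = - a^T)%R by apply/matrixP => i j; rewrite !mxE.
by rewrite /quad e mulmxN !mulNmx opprK.
Qed.

Let quad0 : quad Sigma 0 = 0%R.
Proof. by rewrite /quad mulmx0 mxE. Qed.

(** The only access to beta is through the laws of its linear forms. *)
Lemma ge0_integral_linear_form (a : 'cV[R]_n) (f : R -> \bar R) :
  a != 0%R -> measurable_fun setT f -> (forall t, 0 <= f t) ->
  \int[beta]_y f (linear_form a y) =
  \int[normal_prob 0 (Num.sqrt (quad Sigma a))]_t f t.
Proof.
move=> a0 mf f0.
have ml := measurable_linear_form a.
have ml' : measurable_fun (U := measurableTypeR R) setT (linear_form a) := ml.
have mf' : measurable_fun (T := measurableTypeR R) setT f := mf.
rewrite -[LHS](ge0_integral_pushforward ml' beta measurableT mf')//.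
apply: (eq_measure_integral (normal_prob 0 (Num.sqrt (quad Sigma a)))) => //.
move=> S mS _.
exact: hbeta.
Qed.

(** The symmetry of beta: <a, .> and <- a, .> have the same variance, hence the
    same law. *)
Lemma integral_linear_form_opp (a : 'cV[R]_n) (f : R -> \bar R) :
  measurable_fun setT f -> (forall t, 0 <= f t) ->
  \int[beta]_y f (- linear_form a y)%R = \int[beta]_y f (linear_form a y).
Proof.
move=> mf f0; under eq_integral do rewrite -linear_formN.
have [->|a0] := eqVneq a 0%R; first by rewrite oppr0.
have aN0 : (- a != 0)%R by rewrite oppr_eq0.
apply: etrans (ge0_integral_linear_form aN0 mf f0) _.
by apply: etrans (esym (ge0_integral_linear_form a0 mf f0)); rewrite quadN.
Qed.

Lemma integral_linear_form_sqr (a : 'cV[R]_n) :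
  \int[beta]_y (linear_form a y ^+ 2)%:E = (quad Sigma a)%:E.
Proof.
have [->|a0] := eqVneq a 0%R.
  rewrite quad0; apply: integral0_eq => y _.
  by rewrite linear_form0 expr0n.
have q0 : (0 < quad Sigma a)%R by apply: hSigma.2.
rewrite (ge0_integral_linear_form (f := fun t => (t ^+ 2)%:E))//.
- by rewrite normal_second_moment ?sqrtr_gt0// sqr_sqrtr// ltW.
- by apply/measurable_EFinP; exact: measurable_funX.
- by move=> t; rewrite lee_fin sqr_ge0.
Qed.

Lemma has_exp_moment_linear_form_sqr (a : 'cV[R]_n) :
  has_exp_moment beta (fun y => linear_form a y ^+ 2)%R.
Proof.
split.
- by apply: measurable_funX; exact: measurable_linear_form.
- by move=> y; exact: sqr_ge0.
have [->|a0] := eqVneq a 0%R.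
  exists 1%R => //.
  under eq_integral do rewrite linear_form0 expr0n mulr0 expR0.
  by rewrite integral_cst_probability ltry.
have q0 : (0 < quad Sigma a)%R by apply: hSigma.2.
pose lam := ((4 * quad Sigma a)^-1)%R.
have lam0 : (0 < lam)%R by rewrite invr_gt0 mulr_gt0.
exists lam => //.
rewrite (ge0_integral_linear_form (f := fun t => (expR (lam * t ^+ 2))%:E))//.
- rewrite normal_exp_sqr_moment ?sqrtr_gt0// ?ltry//.
  rewrite sqr_sqrtr ?(ltW q0)//.
  have -> : (2 * lam * quad Sigma a = 2^-1)%R.
    by rewrite /lam; field; rewrite gt_eqF.
  by rewrite invf_lt1// ltr1n.
- apply/measurable_EFinP; apply: measurableT_comp => //.
  by apply: measurable_funM => //; exact: measurable_funX.
Qed.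

(** The cross term is eliminated by symmetry instead of computing the mean: the
    integrals of (c + l)^2 and (c - l)^2 are equal and add up to that of
    2 c^2 + 2 l^2. *)
Lemma integral_affine_form_sqr (c : R) (a : 'cV[R]_n) :
  \int[beta]_y ((c + linear_form a y) ^+ 2)%:E = (c ^+ 2 + quad Sigma a)%:E.
Proof.
set I := LHS.
have mf : measurable_fun (@setT R) (fun t : R => ((c + t) ^+ 2)%:E).
  by apply/measurable_EFinP; apply: measurable_funX; exact: measurable_funD.
have f0 (t : R) : 0 <= ((c + t) ^+ 2)%:E by rewrite lee_fin sqr_ge0.
have ml := measurable_linear_form a.
have mc (s : R) : measurable_fun setT
    (fun y : vec R n => ((c + s * linear_form a y) ^+ 2)%:E).
  apply/measurable_EFinP; apply: measurable_funX; apply: measurable_funD => //.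
  exact: measurable_funM.
have m2 : measurable_fun setT (fun y : vec R n => (linear_form a y ^+ 2)%:E).
  by apply/measurable_EFinP; exact: measurable_funX.
have I0 : 0 <= I by apply: integral_ge0 => y _; exact: f0.
have II : I + I = (2 * (c ^+ 2 + quad Sigma a))%:E.
  have opp : \int[beta]_y ((c - linear_form a y) ^+ 2)%:E = I.
    exact: integral_linear_form_opp mf f0.
  rewrite -{2}opp.
  rewrite -ge0_integralD//; last 2 first.
  - by have := mc 1%R; under eq_fun do rewrite mul1r.
  - by have := mc (-1)%R; under eq_fun do rewrite mulN1r.
  rewrite mulrDr EFinD [X in _ = _ + X]EFinM -integral_linear_form_sqr.
  rewrite -ge0_integralZl//;
    last by move=> y _; rewrite lee_fin sqr_ge0.
  rewrite -[X in _ = X + _](integral_cst_probability beta) -ge0_integralD//.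
  - by apply: eq_integral => y _; rewrite -EFinM -!EFinD; congr EFin; ring.
  - by move=> y _; rewrite lee_fin mulr_ge0// sqr_ge0.
  - by move=> y _; rewrite -EFinM lee_fin mulr_ge0// sqr_ge0.
  - exact: measurable_funeM.
have Ifin : I \is a fin_num.
  rewrite ge0_fin_numE// ltey; apply/eqP => Iy.
  by move: II; rewrite Iy addye.
move: II; rewrite -(fineK Ifin) -EFinD => -[] e; congr EFin; lra.
Qed.

Lemma has_exp_moment_sqfro_mul m (M : 'M[R]_(m, n)) :
  has_exp_moment beta (fun y => sqfro (M *m colv y)).
Proof.
under eq_fun do rewrite sqfro_mul_colv.
by apply: has_exp_moment_sum => i; exact: has_exp_moment_linear_form_sqr.
Qed.

Lemma integral_sqfro_mul m (M : 'M[R]_(m, n)) (Shalf : 'M[R]_n) :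
  psd_sqrt Shalf Sigma ->
  \int[beta]_y (sqfro (M *m colv y))%:E = (sqfro (M *m Shalf))%:E.
Proof.
move=> [symS _ SS]; under eq_integral do rewrite sqfro_mul_colv -sumEFin.
rewrite ge0_integral_sum//; last 2 first.
- move=> i; apply/measurable_EFinP; apply: measurable_funX.
  exact: measurable_linear_form.
- by move=> i y _; rewrite lee_fin sqr_ge0.
rewrite /sqfro -sumEFin; apply: eq_bigr => i _.
rewrite integral_linear_form_sqr.
congr EFin; rewrite /quad trmxK -SS -{2}symS mulmxA -mulmxA -trmx_mul.
rewrite mxE; apply: eq_bigr => j _.
by rewrite -row_mul !mxE expr2.
Qed.

Lemma has_exp_moment_sqdist (x : vec R n) : has_exp_moment beta (sqdist x).
Proof.
have -> : sqdist x = fun y => (\sum_i (tnth x i - tnth y i) ^+ 2)%R.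
  by apply/funext => y; exact: sqdistE.
apply: has_exp_moment_sum => i.
pose g y := (cst (tnth x i ^+ 2) y + linear_form (delta_mx i ord0) y ^+ 2)%R.
apply: (@has_exp_moment_le _ _ _ _ _ g 2) => //.
- apply: measurable_funX; apply: measurable_funB => //; exact: measurable_tnth.
- move=> y; rewrite sqr_ge0 /g /= linear_form_delta.
  have := sqr_ge0 (tnth x i + tnth y i); nra.
- apply: has_exp_momentD; first by apply: has_exp_moment_cst; exact: sqr_ge0.
  exact: has_exp_moment_linear_form_sqr.
Qed.

Lemma integral_sqdist (x : vec R n) :
  \int[beta]_y (sqdist x y)%:E =
  (\tr Sigma + ((colv x)^T *m colv x) ord0 ord0)%:E.
Proof.
under eq_integral do rewrite sqdistE -sumEFin.
rewrite ge0_integral_sum//; last 2 first.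
- move=> i; apply/measurable_EFinP; apply: measurable_funX.
  by apply: measurable_funB => //; exact: measurable_tnth.
- by move=> i y _; rewrite lee_fin sqr_ge0.
rewrite addrC mxE /mxtrace -big_split -sumEFin; apply: eq_bigr => i _.
under eq_integral do rewrite -[X in (_ - X)%R]linear_form_delta -linear_formN.
rewrite integral_affine_form_sqr quadN; congr EFin.
rewrite !mxE -expr2; congr (_ + _)%R.
rewrite /quad -colE.
by rewrite trmx_delta -rowE !mxE.
Qed.

End gaussian_vectors.

(** * The Sinkhorn ambiguity set *)

Section couplings.
Variables (R : realType) (n : nat).
Local Open Scope ereal_scope.
Variables (alpha P : probability (vec R n) R)
  (pi : probability (vec R n * vec R n)%type R).
Hypothesis hpi : coupling alpha P pi.

Lemma ge0_integral_coupling_fst (f : vec R n -> \bar R) :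
  measurable_fun setT f -> (forall x, 0 <= f x) ->
  \int[pi]_u f u.1 = \int[alpha]_x f x.
Proof.
move=> mf f0.
rewrite -[LHS](ge0_integral_pushforward measurable_fst pi measurableT mf)//.
apply: (eq_measure_integral alpha) => // S mS _.
apply: etrans (hpi.1 S mS); rewrite /pushforward; congr (pi _).
by apply/seteqP; split => -[x y] //= [].
Qed.

Lemma ge0_integral_coupling_snd (f : vec R n -> \bar R) :
  measurable_fun setT f -> (forall x, 0 <= f x) ->
  \int[pi]_u f u.2 = \int[P]_x f x.
Proof.
move=> mf f0.
rewrite -[LHS](ge0_integral_pushforward measurable_snd pi measurableT mf)//.
apply: (eq_measure_integral P) => // S mS _.
apply: etrans (hpi.2 S mS); rewrite /pushforward; congr (pi _).
by apply/seteqP; split => -[x y] //= [].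
Qed.

End couplings.

Section relative_entropy_corollaries.
Context d (X : measurableType d) (R : realType).
Local Open Scope ereal_scope.

Lemma KL_ge0 (pi rho : probability X R) : 0 <= KL pi rho.
Proof.
have := @KL_ge_log_moment _ X R pi rho (cst 0%R) (cst 0%R) (measurable_cst _)
  (measurable_cst _) (fun=> lexx _) (fun=> lexx _).
rewrite /= subrr expR0 !integral_cst_probability !add0e.
by rewrite -[X in X <= _]add0e leeD2rE.
Qed.

Lemma KL_refl (rho : probability X R) : KL rho rho = 0.
Proof.
rewrite (@KL_log_density _ _ _ _ _ (cst 0%R))//=.
  by rewrite integral_cst_probability.
by move=> A mA; rewrite expR0 integral_cst// mul1e.
Qed.

End relative_entropy_corollaries.

Section sinkhorn_ball.
Variables (R : realType) (n N : nat) (Sigma : 'M[R]_n).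
Variables (xihat : 'I_N.+1 -> vec R n) (beta : probability (vec R n) R).
Hypotheses (hSigma : posdef Sigma) (hbeta : is_centered_normal Sigma beta).
Local Open Scope ereal_scope.

Let alpha : probability (vec R n) R := empirical R xihat.
Let rho : probability (vec R n * vec R n)%type R := alpha \x beta.

(** The mean of F over the samples, that is its integral against alpha. *)
Definition sample_mean (F : vec R n -> R) : R :=
  (N.+1%:R^-1 * \sum_(i < N.+1) F (xihat i))%R.

Let integral_alpha (F : vec R n -> R) : measurable_fun setT F ->
  (forall x, (0 <= F x)%R) -> \int[alpha]_x (F x)%:E = (sample_mean F)%:E.
Proof.
move=> mF F0; rewrite ge0_integral_empirical//.
- by rewrite sumEFin -EFinM.
- exact/measurable_EFinP.
Qed.

(** The limit of the smallest feasible radii. *)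
Definition critical_radius : R := (\tr Sigma + sample_mean
  (fun x => ((colv x)^T *m colv x) ord0 ord0))%R.

(* The mean transport cost from x to beta. *)
Let msq (x : vec R n) : R := (\tr Sigma + ((colv x)^T *m colv x) ord0 ord0)%R.

Lemma critical_radiusE : critical_radius = sample_mean msq.
Proof.
rewrite /critical_radius /sample_mean /msq big_split /= mulrDr; congr (_ + _)%R.
rewrite sumr_const card_ord -[X in (_ * X)%R]mulr_natl mulrA.
by rewrite mulVf ?mul1r// pnatr_eq0.
Qed.

Let mdist (x : vec R n) : measurable_fun setT (sqdist x).
Proof. by have [] := has_exp_moment_sqdist hSigma hbeta x. Qed.

Let integral_rho_sqdist : \int[rho]_u (sqdist u.1 u.2)%:E = critical_radius%:E.
Proof.
rewrite ge0_integral_empirical_prod/=.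
- rewrite critical_radiusE /sample_mean EFinM -sumEFin; congr (_ * _).
  by apply: eq_bigr => i _; exact: integral_sqdist.
- by apply/measurable_EFinP; exact: measurable_sqdist.
- by move=> u; rewrite lee_fin sqdist_ge0.
Qed.

Section fixed_regularization.
Variable eps : R.
Hypothesis eps0 : (0 < eps)%R.

(** The normalising constant Z(x) of the density exp(- c(x, .) / eps) with
    respect to beta; the integral is finite since the integrand is at most 1. *)
Definition gibbs_partition (x : vec R n) : R :=
  fine (\int[beta]_y (expR (- (sqdist x y / eps)))%:E).

Let Z := gibbs_partition.

Let mexp (x : vec R n) :
  measurable_fun setT (fun y => (expR (- (sqdist x y / eps)))%:E).
Proof.
apply/measurable_EFinP; apply: measurableT_comp => //.
by apply: measurableT_comp => //; exact: measurable_funM.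
Qed.

Let t0 (x y : vec R n) : (0 <= sqdist x y / eps)%R.
Proof. by rewrite divr_ge0 ?sqdist_ge0// ltW. Qed.

Let ZE x : \int[beta]_y (expR (- (sqdist x y / eps)))%:E = (Z x)%:E.
Proof.
rewrite /Z /gibbs_partition fineK// ge0_fin_numE; last first.
  by apply: integral_ge0 => y _; rewrite lee_fin expR_ge0.
apply: (@le_lt_trans _ _ (\int[beta]_y 1)); last first.
  by rewrite integral_cst_probability ltry.
apply: ge0_le_integral => // y _.
by rewrite lee_fin -[leRHS]expR0 ler_expR oppr_le0.
Qed.

Let Z_le1 x : (Z x <= 1)%R.
Proof.
rewrite -lee_fin -ZE -[leRHS](integral_cst_probability beta).
apply: ge0_le_integral => // y _.
by rewrite lee_fin -[leRHS]expR0 ler_expR oppr_le0.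
Qed.

Let integral_t (x : vec R n) :
  \int[beta]_y (sqdist x y / eps)%:E = (msq x / eps)%:E.
Proof.
under eq_integral do rewrite EFinM.
rewrite ge0_integralZr//.
- by rewrite (integral_sqdist hSigma hbeta) -EFinM.
- exact/measurable_EFinP.
- by move=> y _; rewrite lee_fin sqdist_ge0.
- by rewrite lee_fin invr_ge0 ltW.
Qed.

Let mt (x : vec R n) : measurable_fun setT (fun y => (sqdist x y / eps)%:E).
Proof. by apply/measurable_EFinP; exact: measurable_funM. Qed.

(** Jensen's inequality, from exp(- t) >= exp(- m) (1 + m - t), where m is the
    mean of t = c(x, .) / eps. *)
Lemma gibbs_partition_ge x : (expR (- (msq x / eps)) <= Z x)%R.
Proof.
set m := (msq x / eps)%R; set e := expR (- m).
have e0 : (0 < e)%R by exact: expR_gt0.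
have : (e * (1 + m))%:E <= (Z x)%:E + e%:E * m%:E.
  rewrite -ZE -integral_t -ge0_integralZl//; last 2 first.
  - by move=> y _; rewrite lee_fin.
  - by rewrite lee_fin ltW.
  rewrite -ge0_integralD//; last 2 first.
  - by move=> y _; rewrite -EFinM lee_fin mulr_ge0// ltW.
  - exact: measurable_funeM.
  rewrite -[leLHS](integral_cst_probability beta).
  apply: ge0_le_integral => //.
  - move=> y _; rewrite lee_fin mulr_ge0 ?(ltW e0)// addr_ge0//.
    rewrite divr_ge0 ?(ltW eps0)// -lee_fin -(integral_sqdist hSigma hbeta).
    by apply: integral_ge0 => z _; rewrite lee_fin sqdist_ge0.
  - by apply: emeasurable_funD => //; exact: measurable_funeM.
  - move=> y _; rewrite -EFinM -EFinD lee_fin.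
    have := expR_ge1Dx (- (sqdist x y / eps) + m).
    rewrite expRD -[expR m]invrK -expRN -/e ler_pdivlMr// => h.
    nra.
rewrite -EFinM -EFinD lee_fin; nra.
Qed.

Let Z_gt0 x : (0 < Z x)%R.
Proof. exact: lt_le_trans (expR_gt0 _) (gibbs_partition_ge x). Qed.

(* The logarithm of the Gibbs density with respect to alpha x beta is u - w. *)
Let u x : R := - ln (Z x).
Let w (p : vec R n * vec R n) : R := (sqdist p.1 p.2 / eps)%R.

Let u0 x : (0 <= u x)%R.
Proof. by rewrite /u oppr_ge0 ln_le0. Qed.

Let w0 p : (0 <= w p)%R. Proof. exact: t0. Qed.

Let mw : measurable_fun setT w.
Proof. by apply: measurable_funM => //; exact: measurable_sqdist. Qed.

Let mu : measurable_fun setT u.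
Proof.
apply: measurableT_comp => //.
apply: measurableT_comp; first exact: measurable_ln.
apply: measurableT_comp; first exact: fine_measurable.
apply: (@measurable_fun_fubini_tonelli_F _ _ _ _ _ beta
  (fun p => (expR (- w p))%:E)).
- apply/measurable_EFinP; apply: measurableT_comp => //.
  exact: measurableT_comp.
- by move=> p; rewrite lee_fin expR_ge0.
Qed.

Let mu1 : measurable_fun setT (fun p : (vec R n * vec R n)%type => u p.1).
Proof. exact: (measurableT_comp mu measurable_fst). Qed.

Let v p : R := (u p.1 - w p)%R.

Let mv : measurable_fun setT v. Proof. exact: measurable_funB. Qed.

Let integral_expv x : \int[beta]_y (expR (v (x, y)))%:E = 1.
Proof.
rewrite /v /w /=; under eq_integral do rewrite expRD EFinM.
rewrite ge0_integralZl//.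
rewrite [X in _ * X]ZE -EFinM expRN lnK ?posrE//= mulVf//.
by rewrite gt_eqF.
Qed.

Let v1 : \int[rho]_p (expR (v p))%:E = 1.
Proof.
rewrite ge0_integral_empirical_prod//.
- under eq_bigr do rewrite integral_expv.
  by rewrite sumEFin -EFinM sumr_const card_ord mulVf// pnatr_eq0.
- by apply/measurable_EFinP; exact: measurableT_comp.
Qed.

(** The smallest radius for which the ambiguity set is nonempty. *)
Definition sinkhorn_min : R := (eps * sample_mean u)%R.

Let muE : measurable_fun setT (fun x => (u x)%:E).
Proof. by apply/measurable_EFinP; exact: mu. Qed.

Let uE0 x : 0 <= (u x)%:E. Proof. by rewrite lee_fin. Qed.

Let integral_coupling_u P pi : coupling alpha P pi ->
  \int[pi]_p (u p.1)%:E = (sample_mean u)%:E.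
Proof.
move=> hpi; rewrite -(integral_alpha mu u0).
exact: (ge0_integral_coupling_fst hpi muE uE0).
Qed.

Let integral_cost (pi : probability (vec R n * vec R n)%type R) :
  \int[pi]_p (sqfro (colv p.1 - colv p.2))%:E = eps%:E * \int[pi]_p (w p)%:E.
Proof.
rewrite -ge0_integralZl//; last 3 first.
- exact/measurable_EFinP.
- by move=> p _; rewrite lee_fin.
- by rewrite lee_fin ltW.
apply: eq_integral => p _; rewrite -EFinM; congr EFin.
by rewrite /w mulrC divfK// gt_eqF.
Qed.

Lemma sinkhorn_min_le_cost P pi : coupling alpha P pi ->
  sinkhorn_min%:E <= sinkhorn_cost xihat beta eps pi.
Proof.
move=> hpi; have := KL_ge_log_moment pi rho mu1 mw (fun p => u0 p.1) w0.
rewrite v1 addeA leeD2rE//.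
have -> : \int[pi]_p (u p.1)%:E = (sample_mean u)%:E.
  exact: integral_coupling_u hpi.
move=> h.
rewrite /sinkhorn_cost -/rho /sinkhorn_min EFinM.
rewrite integral_cost.
rewrite -ge0_muleDr ?KL_ge0//; last first.
  by apply: integral_ge0 => p _; rewrite lee_fin.
by rewrite addeC lee_pmul2l// lte_fin.
Qed.

(** The minimum is attained by the Gibbs coupling, of density exp(u - w) with
    respect to alpha x beta, whose first marginal is alpha because the density
    has integral 1 in y for every x. *)
Lemma sinkhorn_min_attained : exists P pi,
  [/\ coupling alpha P pi, P `<< beta &
      sinkhorn_cost xihat beta eps pi = sinkhorn_min%:E].
Proof.
pose pi : probability _ R := exp_probability mv v1.
have piE A : measurable A -> pi A = \int[rho]_(p in A) (expR (v p))%:E by [].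
have mev : measurable_fun setT (fun p => (expR (v p))%:E).
  by apply/measurable_EFinP; exact: measurableT_comp.
have pirho : pi `<< rho by exact: density_dominates piE.
have mp2 : measurable_fun setT (snd : vec R n * vec R n -> vec R n).
  exact: measurable_snd.
pose X2 : {mfun (vec R n * vec R n)%type >-> vec R n} :=
  HB.pack (snd : vec R n * vec R n -> vec R n)
    (isMeasurableFun.Build _ _ _ _ _ mp2).
pose P : probability (vec R n) R := distribution pi X2.
have piST S : measurable S -> pi (S `*` setT) = alpha S.
  move=> mS; rewrite piE; last exact: measurableX.
  rewrite integral_mkcond ge0_integral_empirical_prod/=; last 2 first.
  - apply/(measurable_restrictT _ _).1 => //; first exact: measurableX.
    exact: measurable_funTS.
  - by move=> p; apply: erestrict_ge0 => q _; rewrite lee_fin expR_ge0.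
  rewrite /alpha /= /empirical; congr (_ * _); apply: eq_bigr => i _.
  rewrite diracE; case: (boolP (xihat i \in S)) => xS /=.
    rewrite -[RHS](integral_expv (xihat i)); apply: eq_integral => y _.
    by rewrite patchE ifT// inE /=; split => //; exact: set_mem.
  apply: integral0_eq => y _; rewrite patchE ifF//.
  by apply/negP; rewrite inE /= => -[/mem_set]; rewrite (negbTE xS).
have hpi : coupling alpha P pi.
  split => // S mS; rewrite /P /distribution /pushforward; congr (pi _).
  by apply/seteqP; split => -[x y] //= [].
exists P, pi; split => //.
  apply/null_content_dominatesP => S mS S0.
  have mS2 : measurable (setT `*` S : set (vec R n * vec R n)%type).
    exact: measurableX.
  rewrite -hpi.2//; apply: ((null_content_dominatesP _ _).1 pirho) => //.
  apply: etrans (product_measure1E alpha beta measurableT mS) _.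
  by rewrite S0 mule0.
pose W := \int[pi]_p (w p)%:E.
have W0 : 0 <= W by apply: integral_ge0 => p _; rewrite lee_fin.
have mwE : measurable_fun setT (fun p => (w p)%:E) by exact/measurable_EFinP.
have meu : measurable_fun setT
    (fun p : (vec R n * vec R n)%type => (expR (u p.1))%:E).
  by apply/measurable_EFinP; exact: measurableT_comp.
have Wfin : W \is a fin_num.
  rewrite ge0_fin_numE// /W.
  rewrite (@integral_density _ _ _ rho pi (fun p => expR (v p)))//; last first.
    exact: measurableT_comp.
  apply: (@le_lt_trans _ _ (\int[rho]_p (expR (u p.1))%:E)).
    apply: ge0_le_integral => //.
    - by move=> p _; rewrite -EFinM lee_fin mulr_ge0// expR_ge0.
    - exact: emeasurable_funM.
    - move=> p _; rewrite -EFinM lee_fin /v expRD mulrCA.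
      by rewrite ler_piMr ?expR_ge0// mulr_expRN_le1.
  rewrite ge0_integral_empirical_prod//.
  under eq_bigr do rewrite /= integral_cst_probability.
  by rewrite sumEFin -EFinM ltry.
rewrite /sinkhorn_cost -/rho integral_cost -/W.
rewrite (KL_log_density mv piE).
have -> : \int[pi]_p (v p)%:E = (sample_mean u)%:E - W.
  rewrite -(integral_coupling_u hpi) -integralB_EFin//.
  - apply/integrableP; split; first exact/measurable_EFinP.
    under eq_integral do rewrite gee0_abs ?lee_fin//.
    by rewrite (integral_coupling_u hpi) ltry.
  - apply/integrableP; split => //.
    under eq_integral do rewrite gee0_abs ?lee_fin//.
    by rewrite -ge0_fin_numE.
rewrite -(fineK Wfin) -EFinB -!EFinM -EFinD /sinkhorn_min; congr EFin; ring.
Qed.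

Lemma sinkhorn_min_le : (sinkhorn_min <= critical_radius)%R.
Proof.
rewrite /sinkhorn_min critical_radiusE /sample_mean mulrCA.
rewrite ler_wpM2l ?invr_ge0//.
rewrite mulr_sumr; apply: ler_sum => i _.
rewrite mulrC -ler_pdivlMr// /u lerNl.
by rewrite -[leLHS]expRK ler_ln ?posrE ?expR_gt0// gibbs_partition_ge.
Qed.

(** The integral of |x - y|^4 against beta(dy); it is finite, so that taking its
    real part loses nothing. *)
Definition fourth_moment (x : vec R n) : R :=
  fine (\int[beta]_y (sqdist x y ^+ 2)%:E).

Let fourth_momentE x :
  \int[beta]_y (sqdist x y ^+ 2)%:E = (fourth_moment x)%:E.
Proof.
rewrite /fourth_moment fineK// ge0_fin_numE.
  exact: has_exp_moment_integral_sqr (has_exp_moment_sqdist hSigma hbeta x).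
by apply: integral_ge0 => y _; rewrite lee_fin sqr_ge0.
Qed.

Let partition_le x : (Z x + msq x / eps <= 1 + eps ^- 2 * fourth_moment x)%R.
Proof.
have e20 : (0 <= eps ^- 2)%R by rewrite invr_ge0 exprn_ge0// ltW.
have msq2 : measurable_fun setT (fun y => (sqdist x y ^+ 2)%:E).
  by apply/measurable_EFinP; exact: measurable_funX.
rewrite -lee_fin !EFinD [X in _ <= _ + X]EFinM -fourth_momentE -ZE -integral_t.
rewrite -ge0_integralZl//; last by move=> y _; rewrite lee_fin sqr_ge0.
rewrite -ge0_integralD//; last by move=> y _; rewrite lee_fin.
rewrite -[X in _ <= X + _](integral_cst_probability beta).
rewrite -ge0_integralD//; last 2 first.
- by move=> y _; rewrite -EFinM lee_fin mulr_ge0// sqr_ge0.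
- exact: measurable_funeM.
apply: ge0_le_integral => //.
- by move=> y _; rewrite -EFinD lee_fin addr_ge0// expR_ge0.
- exact: emeasurable_funD.
- by apply: emeasurable_funD => //; exact: measurable_funeM.
- move=> y _; rewrite -EFinM -!EFinD lee_fin.
  have := expRN_le (t0 x y); rewrite expr_div_n => h.
  by rewrite (GRing.mulrC (eps ^- 2)%R); lra.
Qed.

Lemma sinkhorn_min_ge :
  (critical_radius - sample_mean fourth_moment / eps <= sinkhorn_min)%R.
Proof.
rewrite /sinkhorn_min critical_radiusE /sample_mean -mulrA -mulrBr mulrCA.
rewrite ler_wpM2l ?invr_ge0// mulr_suml -sumrB mulr_sumr; apply: ler_sum => i _.
set x := xihat i.
have h1 : (1 - Z x <= u x)%R.
  have /le_ln1Dx : (-1 < Z x - 1)%R by rewrite ltrBrDr addNr.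
  by rewrite addrC subrK /u => h; lra.
have h2 := partition_le x.
have h3 : (eps * (msq x / eps - eps ^- 2 * fourth_moment x) <= eps * u x)%R.
  by rewrite ler_pM2l//; lra.
apply: le_trans h3; rewrite le_eqVlt; apply/orP; left; apply/eqP.
by field; rewrite gt_eqF.
Qed.

End fixed_regularization.

Lemma ambiguity_set_nonempty (eps theta : R) : (0 < eps)%R ->
  ambiguity_set xihat beta eps theta !=set0 <-> (sinkhorn_min eps <= theta)%R.
Proof.
move=> eps0; split.
- move=> [P [_ dP]]; rewrite -lee_fin; apply: le_trans dP.
  apply: le_ereal_inf_tmp => _ [pi hpi <-]; exact: sinkhorn_min_le_cost hpi.
- move=> mt; have [P [pi [hpi Pb cE]]] := sinkhorn_min_attained eps0.
  exists P; split => //; apply: (@le_trans _ _ (sinkhorn_min eps)%:E).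
    by rewrite -cE; apply: ereal_inf_lbound; exists pi.
  by rewrite lee_fin.
Qed.

(** The product coupling has no entropy and costs exactly the critical radius;
    eps is arbitrary. *)
Lemma reference_in_ambiguity_set (eps theta : R) :
  (critical_radius <= theta)%R -> ambiguity_set xihat beta eps theta beta.
Proof.
move=> rt; split; first by apply/null_content_dominatesP.
apply: (@le_trans _ _ critical_radius%:E); last by rewrite lee_fin.
apply: ereal_inf_lbound; exists rho.
  split => S mS.
    apply: etrans (product_measure1E alpha beta mS measurableT) _.
    by rewrite -[RHS]mule1; congr (_ * _); exact: probability_setT.
  apply: etrans (product_measure1E alpha beta measurableT mS) _.
  by rewrite -[RHS]mul1e; congr (_ * _); exact: probability_setT.
by rewrite /sinkhorn_cost integral_rho_sqdist KL_refl mule0 adde0.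
Qed.

Lemma cvg_sinkhorn_min : sinkhorn_min eps @[eps --> +oo%R] --> critical_radius.
Proof.
pose K := sample_mean fourth_moment.
have cvgV : (eps : R)^-1%R @[eps --> +oo%R] --> (0%R : R).
  by apply/(gtr0_cvgV0 (f := id)); [exact: nbhs_pinfty_gt|exact: cvg_id].
apply: (@squeeze_cvgr _ _ _ _ (fun eps => critical_radius - K / eps)%R
  (fun=> critical_radius)).
- near=> eps; have eps0 : (0 < eps)%R by near: eps; exact: nbhs_pinfty_gt.
  by rewrite sinkhorn_min_ge//= sinkhorn_min_le.
- rewrite -[X in _ --> X]subr0; apply: cvgB; first exact: cvg_cst.
  by rewrite -[X in _ --> X](mulr0 K); apply: cvgM => //; exact: cvg_cst.
- exact: cvg_cst.
Unshelve. all: by end_near.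
Qed.

Section worst_case_expectation.
Variables (f : vec R n -> R) (H : R).
Hypotheses (hf : has_exp_moment beta f) (fH : \int[beta]_y (f y)%:E = H%:E).

Let mf : measurable_fun setT f. Proof. by case: hf. Qed.

Let f0 y : (0 <= f y)%R. Proof. by case: hf. Qed.

Let H0 : (0 <= H)%R.
Proof.
by rewrite -lee_fin -fH; apply: integral_ge0 => y _; rewrite lee_fin.
Qed.

(** The variational inequality with u = lam f(y) and w = 0: eps times the
    relative entropy of a coupling is at most its cost, whose infimum is at most
    theta. *)
Lemma worst_case_le : exists lam0 K : R, [/\ (0 < lam0)%R, (0 <= K)%R &
  forall eps theta lam, (0 < eps)%R -> (0 < lam <= lam0)%R ->
    worst_case xihat beta eps theta f <=
    (theta / eps / lam + (H + lam * K))%:E].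
Proof.
have [lam0 [K [lam00 K0 expand]]] := has_exp_moment_expansion hf.
exists lam0, K; split => // eps theta lam eps0 lamP.
have /andP[l0 _] := lamP.
apply: ge_ereal_sup => _ [P [_ dP] <-].
set J := \int[P]_xi (f xi)%:E.
pose r := (lam * H + lam ^+ 2 * K)%R.
have r0 : (0 <= r)%R by rewrite addr_ge0// mulr_ge0 ?exprn_ge0// ltW.
have bound pi : coupling alpha P pi ->
    (eps * lam)%:E * J - (eps * r)%:E <= sinkhorn_cost xihat beta eps pi.
  move=> hpi.
  have mlf2 : measurable_fun setT
      (fun p : (vec R n * vec R n)%type => lam * f p.2)%R.
    apply: measurable_funM => //.
    exact: (measurableT_comp mf measurable_snd).
  have := @KL_ge_log_moment _ _ R pi rho _ (cst 0%R) mlf2 (measurable_cst _)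
    (fun p => mulr_ge0 (ltW l0) (f0 p.2)) (fun=> lexx _).
  have -> : \int[pi]_p (lam * f p.2)%:E = lam%:E * J.
    under eq_integral do rewrite EFinM.
    rewrite ge0_integralZl//; last 3 first.
    - by apply/measurable_EFinP; exact: (measurableT_comp mf measurable_snd).
    - by move=> p _; rewrite lee_fin.
    - by rewrite lee_fin ltW.
    congr (_ * _); apply: (ge0_integral_coupling_snd hpi (f := EFin \o f)).
      exact/measurable_EFinP.
    by move=> y; rewrite lee_fin.
  have -> : \int[rho]_p (expR (lam * f p.2 - cst 0%R p))%:E =
      \int[beta]_y (expR (lam * f y))%:E.
    under eq_integral do rewrite subr0.
    rewrite ge0_integral_empirical_prod//=; last first.
      by apply/measurable_EFinP; exact: measurableT_comp.
    rewrite sumr_const card_ord -[X in _ * X](mule_natl _ N.+1) muleA -EFinM.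
    by rewrite mulVf ?mul1e.
  rewrite /= integral_cst_probability add0e => h.
  have {h} : lam%:E * J + 1 <= KL pi rho + r%:E + 1.
    apply: (le_trans h); rewrite -addeA leeD2l//.
    by rewrite addeC (le_trans (expand _ lamP))// fH -EFinM -EFinD.
  rewrite leeD2rE// => h.
  rewrite EFinN leeBlDr// (@le_trans _ _ (eps%:E * (KL pi rho + r%:E)))//.
    by rewrite EFinM -muleA lee_pmul2l// lte_fin.
  rewrite ge0_muleDr ?KL_ge0 ?lee_fin// -EFinM leeD2r//.
  rewrite leeDr//; apply: integral_ge0 => p _.
  by rewrite lee_fin sqfro_ge0.
have : (eps * lam)%:E * J - (eps * r)%:E <= theta%:E.
  apply: le_trans dP; apply: le_ereal_inf_tmp => _ [pi hpi <-].
  exact: bound hpi.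
rewrite leeBlDr// -EFinD -lee_pdivlMl ?mulr_gt0// -EFinM => /le_trans; apply.
rewrite lee_fin le_eqVlt; apply/orP; left; apply/eqP.
by rewrite /r; field; rewrite !gt_eqF.
Qed.

Lemma worst_case_ge eps theta : (critical_radius <= theta)%R ->
  H%:E <= worst_case xihat beta eps theta f.
Proof.
move=> rt; rewrite -fH; apply: ereal_sup_ubound; exists beta => //.
exact: reference_in_ambiguity_set.
Qed.

Lemma cvg_worst_case (theta : R -> R) :
  (\forall eps \near +oo%R, (critical_radius <= theta eps)%R) ->
  (theta eps / eps)%R @[eps --> +oo%R] --> (0%R : R) ->
  worst_case xihat beta eps (theta eps) f @[eps --> +oo%R] --> H%:E.
Proof.
move=> rt t0; have [lam0 [K [lam00 K0 ub]]] := worst_case_le.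
have K10 : (0 < K + 1)%R by rewrite ltr_pwDr.
(* For a margin e, lam is chosen to make lam K <= e / 2, then eps to make
   theta / eps <= lam e / 2. *)
have sq e : (0 < e)%R -> \forall eps \near +oo%R,
    H%:E <= worst_case xihat beta eps (theta eps) f <= (H + e)%:E.
  move=> e0; pose lam := Num.min lam0 (e / 2 / (K + 1))%R.
  have l0 : (0 < lam)%R by rewrite lt_min lam00 !divr_gt0.
  have lK : (lam * K <= e / 2)%R.
    apply: (@le_trans _ _ (lam * (K + 1))%R); first by rewrite ler_pM2l// lerDl.
    by rewrite -ler_pdivlMr// ge_min lexx orbT.
  near=> eps.
  have eps0 : (0 < eps)%R by near: eps; exact: nbhs_pinfty_gt.
  apply/andP; split; first by apply: worst_case_ge; near: eps.
  apply: (le_trans (ub eps (theta eps) lam eps0 _)).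
    by rewrite l0 ge_min lexx.
  rewrite lee_fin addrCA lerD2l [leRHS]splitr lerD//.
  rewrite ler_pdivrMr//.
  have : (`|0 - theta eps / eps| <= e / 2 * lam)%R.
    near: eps; move/cvgrPdist_le : t0; apply.
    by rewrite mulr_gt0// divr_gt0.
  by rewrite sub0r normrN ler_norml => /andP[].
apply/fine_cvgP; split.
  apply: filterS (sq 1%R ltr01) => eps /andP[h1 h2].
  by rewrite fin_real// (lt_le_trans _ h1) ?ltNyr//= (le_lt_trans h2)// ltry.
apply/cvgrPdist_le => e e0.
apply: filterS (sq e e0) => eps /andP[h1 h2].
have wfin : worst_case xihat beta eps (theta eps) f \is a fin_num.
  by rewrite fin_real// (lt_le_trans _ h1) ?ltNyr//= (le_lt_trans h2)// ltry.
move: h1 h2; rewrite /= -(fineK wfin) !lee_fin => h1 h2.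
by rewrite ler_norml; apply/andP; split; lra.
Unshelve. all: by end_near.
Qed.

End worst_case_expectation.

End sinkhorn_ball.

(** * The limiting design problem *)

Lemma eq_optimal (R : realType) (X : Type) (feas : X -> Prop)
    (cost cost' : X -> \bar R) (x : X) :
  cost =1 cost' -> optimal feas cost x <-> optimal feas cost' x.
Proof. by move=> /funext ->. Qed.

Unset Implicit Arguments.
Set Strict Implicit.
Set Printing Implicit Defensive.

Theorem theorem4 (R : realType) (nx nw ny : nat)
  (A : nat -> 'M[R]_(nx, nx)) (B : nat -> 'M[R]_(nx, nw))
  (C : nat -> 'M[R]_(ny, nx)) (D : nat -> 'M[R]_(ny, nw))
  (t0 T : nat) (N : nat)
  (Sigma Shalf : 'M[R]_(n_xi nx nw T))
  (xihat : 'I_N.+1 -> vec R (n_xi nx nw T))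
  (beta : probability (vec R (n_xi nx nw T)) R)
  (hobs : uniformly_completely_observable A C)
  (hT : (nx <= T)%N)
  (hSigma : posdef Sigma) (hShalf : psd_sqrt Shalf Sigma)
  (hbeta : is_centered_normal Sigma beta) :
  let radius : R :=
    \tr Sigma + N.+1%:R^-1 *
      \sum_(i < N.+1) ((colv (xihat i))^T *m colv (xihat i)) ord0 ord0 in
  [/\ forall theta : R,
        (\forall eps \near +oo, ambiguity_set xihat beta eps theta !=set0)
        <-> radius <= theta,
      exists theta_min : R -> R,
        (forall eps theta : R, 0 < eps ->
           ambiguity_set xihat beta eps theta !=set0 <-> theta_min eps <= theta)
        /\ theta_min eps @[eps --> +oo] --> radius
    & forall theta : R -> R,
        (\forall eps \near +oo, radius <= theta eps) ->
        theta eps / eps @[eps --> +oo] --> 0 ->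
        let cost (eps : R) (Phi : design R nx ny T) : \bar R :=
          worst_case xihat beta eps (theta eps) (sq_error B D t0 Phi) in
        (forall Phi : design R nx ny T, design_constraints A C t0 Phi ->
           cvg (cost eps Phi @[eps --> +oo]))
        /\ (forall Phi : design R nx ny T,
              optimal (design_constraints A C t0 (T := T))
                (fun Psi => lim (cost eps Psi @[eps --> +oo])) Phi
              <-> optimal (design_constraints A C t0 (T := T))
                    (fun Psi => (H2_cost B D t0 Shalf Psi)%:E) Phi)].
Proof.
move=> radius.
have cvg_min : sinkhorn_min xihat beta eps @[eps --> +oo] --> radius.
  exact: cvg_sinkhorn_min.
split.
- move=> theta; split=> [feas|le_theta].
    rewrite leNgt; apply/negP => lt_radius.
    have near_gt : \forall eps \near +oo, theta < sinkhorn_min xihat beta eps.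
      exact: cvgr_gt cvg_min _ lt_radius.
    have near_gt0 : \forall eps \near +oo, 0 < eps :> R.
      exact: nbhs_pinfty_gt.
    have [eps [ne [gt_theta eps0]]] :=
      filter_ex (filterI feas (filterI near_gt near_gt0)).
    move/(ambiguity_set_nonempty xihat hSigma hbeta theta eps0) : ne.
    by rewrite leNgt gt_theta.
  apply: nearW => eps; exists beta.
  by apply: (reference_in_ambiguity_set hSigma hbeta); exact: le_theta.
- exists (sinkhorn_min xihat beta); split=> // eps theta eps0.
  exact: (ambiguity_set_nonempty xihat hSigma hbeta theta eps0).
- move=> theta le_theta theta0 cost.
  have cvg_cost (Phi : design R nx ny T) :
      cost eps Phi @[eps --> +oo] --> (H2_cost B D t0 Shalf Phi)%:E.
    pose M := Phimx Phi *m Qmx B D t0 T.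
    apply: (cvg_worst_case hSigma hbeta _ _ le_theta theta0).
      exact: (has_exp_moment_sqfro_mul hSigma hbeta M).
    exact: (integral_sqfro_mul hSigma hbeta M hShalf).
  have lim_cost Phi : lim (cost eps Phi @[eps --> +oo]) =
      (H2_cost B D t0 Shalf Phi)%:E.
    by apply/cvg_lim => //; exact: cvg_cost.
  split=> [Phi _|Phi]; first by apply: cvgP; exact: cvg_cost.
  exact: eq_optimal.
Qed.
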